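(* Let $T$ be a complete first-order theory with monster model $\mathcal M$ and let $\boldsymbol e=a/E$ be a hyperimaginary. Let $H'\le\operatorname{Gal}_{\operatorname L}(T,\boldsymbol e)$ be a closed subgroup, let $F$ be an $\emptyset$-type-definable equivalence relation, and let $H=\pi^{-1}(H')\le\operatorname{Aut}_{\boldsymbol e}(\mathcal M)$. Then the orbit equivalence relation $x_F\equiv^H_{\boldsymbol e}y_F$ is equivalent to $x_F\equiv_{\boldsymbol e'\boldsymbol e}y_F$ for some hyperimaginary $\boldsymbol e'\in\operatorname{bdd}(\boldsymbol e)$, and hence $x_F\equiv^H_{\boldsymbol e}y_F$ is an $\boldsymbol e'\boldsymbol e$-invariant type-definable bounded equivalence relation. In particular, if $H'$ is normal in $\operatorname{Gal}_{\operatorname L}(T,\boldsymbol e)$, then $x_F\equiv^H_{\boldsymbol e}y_F$ is $\boldsymbol e$-invariant.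
   Context: Conventions: $\mathcal M$ is a ($\bar\kappa$-saturated) monster model of $T$; small/bounded means of cardinality $<\bar\kappa$; real tuples are sequences from $\mathcal M$ of small length; type-definable means type-definable over some small real set. A hyperimaginary $b_F=b/F$ is the class of a real tuple $b$ modulo an $\emptyset$-type-definable equivalence relation $F$; $b_F\equiv_{\boldsymbol c}d_F$ means that some automorphism fixing the hyperimaginary (or sequence of hyperimaginaries) $\boldsymbol c$ sends $b_F$ to $d_F$. Here $E$ is an $\emptyset$-type-definable equivalence relation, $a$ a real tuple, $\boldsymbol e=a/E$. $\operatorname{Aut}_{\boldsymbol e}(\mathcal M)=\{f\in\operatorname{Aut}(\mathcal M): f(\boldsymbol e)=\boldsymbol e\}$. $\boldsymbol e'\in\operatorname{bdd}(\boldsymbol e)$ means $\{f(\boldsymbol e'):f\in\operatorname{Aut}_{\boldsymbol e}(\mathcal M)\}$ is bounded; $\boldsymbol e'\in\operatorname{dcl}(\boldsymbol e)$ means every $f\in\operatorname{Aut}_{\boldsymbol e}(\mathcal M)$ fixes $\boldsymbol e'$ (similarly over a small model). $\operatorname{Autf}_{\boldsymbol e}(\mathcal M)$ is the (normal) subgroup of $\operatorname{Aut}_{\boldsymbol e}(\mathcal M)$ generated by all $f\in \operatorname{Aut}_{\boldsymbol e}(\mathcal M)$ fixing pointwise some small model $M\prec\mathcal M$ with $\boldsymbol e\in\operatorname{dcl}(M)$. $\operatorname{Gal}_{\operatorname L}(T,\boldsymbol e)=\operatorname{Aut}_{\boldsymbol e}(\mathcal M)/\operatorname{Autf}_{\boldsymbol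 e}(\mathcal M)$, with canonical projection $\pi$. Topology: for small models $M,N$ with $\boldsymbol e\in\operatorname{dcl}(M)$, $\boldsymbol e\in\operatorname{dcl}(N)$, $S_M(N)=\{\operatorname{tp}(f(M)/N): f\in\operatorname{Aut}_{\boldsymbol e}(\mathcal M)\}$ has the relative Stone topology, and $\operatorname{Gal}_{\operatorname L}(T,\boldsymbol e)$ has the quotient topology under the well-defined map $\nu:\operatorname{tp}(f(M)/N)\mapsto\pi(f)$ (independent of $M,N$). For $H\le\operatorname{Aut}_{\boldsymbol e}(\mathcal M)$, $b_F\equiv^H_{\boldsymbol e}c_F$ iff there is $h\in H$ with $h(b_F)=c_F$; it is viewed as an equivalence relation on real tuples $x,y$, coarser than $F$. An equivalence relation is bounded if it has boundedly many classes; it is $\boldsymbol e$-invariant (resp. $\boldsymbol e'\boldsymbol e$-invariant) if it is invariant under all automorphisms fixing $\boldsymbol e$ (resp. both $\boldsymbol e'$ and $\boldsymbol e$). *)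

(* Defs.v *)
From Stdlib Require Import RelationClasses.
From HB Require Import structures.
From mathcomp Require Import all_boot.
From mathcomp Require Import all_classical topology.

Set Implicit Arguments.
Unset Strict Implicit.
Unset Printing Implicit Defensive.

Local Open Scope classical_set_scope.
Local Open Scope card_scope.
Local Open Scope quotient_scope.
Local Open Scope group_scope.

Record language := Language {
  fsymb : Type;
  farity : fsymb -> nat;
  rsymb : Type;
  rarity : rsymb -> nat }.

Inductive term (L : language) (V : Type) : Type :=
| Var of V
| App (f : fsymb L) of 'I_(farity f) -> term L V.

(* [formula L V]: formulas whose free variables lie in [V]; the type [V] may be
   infinite (variables of an infinite tuple, or constants naming parameters).
   [All] binds the extra variable [None]. *)
Inductive formula (L : language) (V : Type) : Type :=
| Bot
| Eq of term L V & term L V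
| Rel (r : rsymb L) of 'I_(rarity r) -> term L V
| Imp of formula L V & formula L V
| All of formula L (option V).

Arguments Bot {L V}.

Definition Neg (L : language) (V : Type) (phi : formula L V) : formula L V :=
  Imp phi Bot.

HB.instance Definition _ (L : language) (V : Type) :=
  gen_eqMixin (formula L V).
HB.instance Definition _ (L : language) (V : Type) :=
  gen_choiceMixin (formula L V).
HB.instance Definition _ (L : language) (V : Type) :=
  isPointed.Build (formula L V) Bot.

Record structure (L : language) := Structure {
  carrier :> Type;
  carrier_inhabited : inhabited carrier;
  fint : forall f : fsymb L, ('I_(farity f) -> carrier) -> carrier;
  rint : forall r : rsymb L, ('I_(rarity r) -> carrier) -> Prop }.

Section Semantics.
Variables (L : language) (M : structure L).

Fixpoint eval (V : Type) (v : V -> M) (t : term L V) : M :=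
  match t with
  | Var x => v x
  | App f ts => fint (fun i => eval v (ts i))
  end.

Fixpoint sat (V : Type) (phi : formula L V) : (V -> M) -> Prop :=
  match phi with
  | Bot => fun _ => False
  | Eq t u => fun v => eval v t = eval v u
  | Rel r ts => fun v => rint (fun i => eval v (ts i))
  | Imp p q => fun v => sat p v -> sat q v
  | All p => fun v => forall m : M,
      sat p (fun o => if o is Some x then v x else m)
  end.

End Semantics.

Lemma sat_iso (L : language) (M N : structure L) (h : M -> N) (h' : N -> M) :
    cancel h h' -> cancel h' h ->
    (forall (f : fsymb L) (x : 'I_(farity f) -> M),
       h (fint x) = fint (h \o x)) ->
    (forall (r : rsymb L) (x : 'I_(rarity r) -> M),
       rint (h \o x) <-> rint x) ->
  forall (V : Type) (phi : formula L V) (v : V -> M),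
    sat phi (h \o v) <-> sat phi v.
Proof.
move=> hK h'K hf hr.
have heval V (t : term L V) v : eval (h \o v) t = h (eval v t).
  elim: t => //= f ts IH; rewrite hf; congr fint.
  by apply/funext => i /=.
move=> V; elim=> {V} [V|V t u|V r ts|V p IHp q IHq|V p IHp] v //=.
- by rewrite !heval; split=> [/(can_inj hK)|->].
- rewrite -hr; suff -> : (fun i => eval (h \o v) (ts i)) =
    h \o (fun i => eval v (ts i)) by [].
  by apply/funext => i /=.
- by rewrite IHp IHq.
- split=> H m.
    rewrite -IHp; have := H (h m); congr sat.
    by apply/funext => -[].
  have /IHp := H (h' m); congr sat.
  by apply/funext => -[]//=; rewrite h'K.
Qed.

Definition sentence (L : language) : Type := formula L void.

Definition models (L : language) (M : structure L) (T : set (sentence L)) :=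
  forall s, T s -> sat s (of_void M).

Definition entails (L : language) (T : set (sentence L)) (s : sentence L) :=
  forall M : structure L, models M T -> sat s (of_void M).

Definition complete_theory (L : language) (T : set (sentence L)) :=
  (exists M : structure L, models M T) /\
  forall s, entails T s \/ entails T (Neg s).

Definition tcat (T I J : Type) (x : I -> T) (y : J -> T) (k : I + J) : T :=
  match k with inl i => x i | inr j => y j end.

(* [|A| < |K|]; the cardinal bound of the monster model is given by a type [K] of
   that cardinality. *)
Definition small (K : Type) (T : Type) (A : set T) : Prop :=
  A #<= [set: K] /\ ~ ([set: K] #<= A).

(* Over a small set there are then boundedly many types in a given small tuple
   of variables. *)
Definition uncountable_strong_limit (K : Type) : Prop :=
  small K [set: nat] /\
  forall X : Type, small K [set: X] -> small K [set: set X].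

(* [formula L (I + A)]: formulas in the variables of an [I]-tuple, with
   parameters from [A]. *)
Definition sat_in (L : language) (M : structure L) (A : set M) (I : Type)
    (phi : formula L (I + A)) (x : I -> M) : Prop :=
  sat phi (tcat x (val : A -> M)).

Definition finitely_satisfiable (L : language) (M : structure L) (A : set M)
    (I : Type) (p : set (formula L (I + A))) : Prop :=
  forall D, finite_set D -> D `<=` p ->
    exists x : I -> M, forall phi, D phi -> sat_in phi x.

Definition saturated (K : Type) (L : language) (M : structure L) : Prop :=
  forall (A : set M) (p : set (formula L (unit + A))),
    small K A -> finitely_satisfiable p ->
    exists x : unit -> M, forall phi, p phi -> sat_in phi x.

Record aut (L : language) (M : structure L) := Aut {
  aut_fun :> M -> M;
  aut_inv : M -> M;
  aut_funK : cancel aut_fun aut_inv;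
  aut_invK : cancel aut_inv aut_fun;
  aut_fint : forall (f : fsymb L) (x : 'I_(farity f) -> M),
    aut_fun (fint x) = fint (aut_fun \o x);
  aut_rint : forall (r : rsymb L) (x : 'I_(rarity r) -> M),
    rint (aut_fun \o x) <-> rint x }.

Definition strongly_homogeneous (K : Type) (L : language) (M : structure L) :=
  forall (A : set M) (g : A -> M), small K A ->
    (forall phi : formula L A, sat phi (val : A -> M) <-> sat phi g) ->
    exists f : aut M, forall a : A, f (val a) = g a.

Record monster (K : Type) (L : language) (T : set (sentence L))
    (M : structure L) : Prop := Monster {
  monster_card : uncountable_strong_limit K;
  monster_fsymb : small K [set: fsymb L];
  monster_rsymb : small K [set: rsymb L];
  monster_models : models M T;
  monster_saturated : saturated K M;
  monster_homogeneous : strongly_homogeneous K M }.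

Definition elementary_substructure (L : language) (M : structure L)
    (A : set M) : Prop :=
  exists (A_inh : inhabited A)
    (fA : forall f : fsymb L, ('I_(farity f) -> A) -> A)
    (rA : forall r : rsymb L, ('I_(rarity r) -> A) -> Prop),
  forall (V : Type) (phi : formula L V) (v : V -> A),
    @sat L (Structure A_inh fA rA) V phi v <->
    sat phi (fun x => val (v x) : M).

Section AutGroup.
Variables (L : language) (M : structure L).
Implicit Types f g h : aut M.

Lemma aut_ext f g : f =1 g -> f = g.
Proof.
case: f g => [f f' fK f'K fF fR] [g g' gK g'K gF gR] /= /funext fg; subst g.
have f'g' : f' = g'.
  by apply/funext => x; rewrite -[x in LHS]g'K fK.
subst g'; congr Aut; exact: Prop_irrelevance.
Qed.

Program Definition aut_mul f g : aut M :=
  @Aut L M (f \o g) (aut_inv g \o aut_inv f) _ _ _ _.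
Next Obligation. by move=> f g x /=; rewrite !aut_funK. Qed.
Next Obligation. by move=> f g x /=; rewrite !aut_invK. Qed.
Next Obligation. by move=> f g s x /=; rewrite !aut_fint. Qed.
Next Obligation.
by move=> f g r x; rewrite -[_ \o x]/(f \o (g \o x)) !aut_rint.
Qed.

Program Definition aut_one : aut M := @Aut L M id id _ _ _ _.
Next Obligation. by []. Qed.
Next Obligation. by []. Qed.
Next Obligation. by []. Qed.
Next Obligation. by []. Qed.

Program Definition aut_invg f : aut M := @Aut L M (aut_inv f) f _ _ _ _.
Next Obligation. exact: aut_invK. Qed.
Next Obligation. exact: aut_funK. Qed.
Next Obligation.
move=> f s x; apply: (can_inj (@aut_funK L M f)).
rewrite aut_invK aut_fint; congr fint.
by apply/funext => i /=; rewrite aut_invK.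
Qed.
Next Obligation.
move=> f r x; rewrite -(aut_rint f); suff -> : f \o (aut_inv f \o x) = x by [].
by apply/funext => i /=; rewrite aut_invK.
Qed.

HB.instance Definition _ := gen_eqMixin (aut M).
HB.instance Definition _ := gen_choiceMixin (aut M).

Lemma aut_mulA : associative aut_mul. Proof. by move=> f g h; apply: aut_ext. Qed.
Lemma aut_mul1 : left_id aut_one aut_mul. Proof. by move=> f; apply: aut_ext. Qed.
Lemma aut_mulr1 : right_id aut_one aut_mul. Proof. by move=> f; apply: aut_ext. Qed.
Lemma aut_mulV : left_inverse aut_one aut_invg aut_mul.
Proof. by move=> f; apply: aut_ext => x /=; rewrite aut_funK. Qed.
Lemma aut_mulrV : right_inverse aut_one aut_invg aut_mul.
Proof. by move=> f; apply: aut_ext => x /=; rewrite aut_invK. Qed.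

HB.instance Definition _ :=
  isGroup.Build (aut M) aut_mulA aut_mul1 aut_mulr1 aut_mulV aut_mulrV.

End AutGroup.

Record complete_type (L : language) (M : structure L) (A : set M) (I : Type) :=
  CompleteType {
    ct_set :> set (formula L (I + A));
    ct_consistent : finitely_satisfiable ct_set;
    ct_complete : forall phi, ct_set phi \/ ct_set (Neg phi) }.

HB.instance Definition _ (L : language) (M : structure L) (A : set M)
  (I : Type) := gen_eqMixin (complete_type A I).
HB.instance Definition _ (L : language) (M : structure L) (A : set M)
  (I : Type) := gen_choiceMixin (complete_type A I).
HB.instance Definition _ (L : language) (M : structure L) (A : set M)
    (I : Type) :=
  isSubBaseTopological.Build (complete_type A I) setT
    (fun phi : formula L (I + A) => [set p : complete_type A I | ct_set p phi]).

Program Definition tp (L : language) (M : structure L) (A : set M) (I : Type)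
    (x : I -> M) : complete_type A I :=
  @CompleteType L M A I [set phi | sat_in phi x] _ _.
Next Obligation. by move=> L M A I x D _ Dx; exists x. Qed.
Next Obligation. by move=> L M A I x phi; exact: EM. Qed.

Definition type_definable_over (L : language) (M : structure L) (A : set M)
    (I : Type) (R : (I -> M) -> (I -> M) -> Prop) : Prop :=
  exists p : set (formula L ((I + I) + A)),
    forall x y, R x y <-> forall phi, p phi -> sat_in phi (tcat x y).

(* Real tuples of small length are indexed by arbitrary small types [td_idx]. *)
Record tdequiv (K : Type) (L : language) (M : structure L) := TdEquiv {
  td_idx : Type;
  td_rel :> (td_idx -> M) -> (td_idx -> M) -> Prop;
  td_small : small K [set: td_idx];
  td_def : type_definable_over set0 td_rel;
  td_equiv : Equivalence td_rel }.

Definition real_tuple (K : Type) (L : language) (M : structure L)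
  (F : tdequiv K M) : Type := td_idx F -> M.

Definition eqclass (K : Type) (L : language) (M : structure L)
    (F : tdequiv K M) (b : real_tuple F) : set (real_tuple F) :=
  [set x | F b x].

Record hyperimaginary (K : Type) (L : language) (M : structure L) :=
  Hyperimaginary {
    hi_eq : tdequiv K M;
    hi_rep : real_tuple hi_eq }.
Arguments hi_rep {K L M} h.

Definition hi_class (K : Type) (L : language) (M : structure L)
    (e : hyperimaginary K M) : set (real_tuple (hi_eq e)) :=
  eqclass (hi_rep e).
Arguments hi_class {K L M} e.

Definition act (L : language) (M : structure L) (I : Type) (f : aut M)
    (C : set (I -> M)) : set (I -> M) :=
  [set f \o x | x in C].

Section OverHyperimaginary.
Variables (K : Type) (L : language) (M : structure L).
Implicit Types (e : hyperimaginary K M) (F : tdequiv K M) (G : set (aut M)).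

Definition fixing e : set (aut M) :=
  [set f | act f (hi_class e) = hi_class e].

Definition fixing_pointwise (A : set M) : set (aut M) :=
  [set f | forall a, A a -> f a = a].

Definition in_bdd e' e : Prop :=
  small K [set act f (hi_class e') | f in fixing e].

Definition in_dcl_set e (A : set M) : Prop :=
  fixing_pointwise A `<=` fixing e.

(* As relations on real tuples, [orbit_eq] and [equiv_over] compare the classes
   [x_F] and [y_F], not the tuples [x] and [y]. *)
Definition orbit_eq G F (x y : real_tuple F) : Prop :=
  exists2 f, G f & act f (eqclass x) = eqclass y.

Definition equiv_over e' e F (x y : real_tuple F) : Prop :=
  orbit_eq (fixing e' `&` fixing e) x y.

Definition invariant_under G (I : Type)
    (R : (I -> M) -> (I -> M) -> Prop) : Prop :=
  forall f, G f -> forall x y, R x y <-> R (f \o x) (f \o y).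

Definition type_definable (I : Type)
    (R : (I -> M) -> (I -> M) -> Prop) : Prop :=
  exists2 A : set M, small K A & type_definable_over A R.

Definition bounded_equiv (I : Type)
    (R : (I -> M) -> (I -> M) -> Prop) : Prop :=
  Equivalence R /\ small K (range (fun x => [set y | R x y])).

Record model_over e := ModelOver {
  mo_set :> set M;
  mo_small : small K mo_set;
  mo_elementary : elementary_substructure mo_set;
  mo_dcl : in_dcl_set e mo_set }.

End OverHyperimaginary.

Arguments orbit_eq {K L M} G F x y.
Arguments equiv_over {K L M} e' e F x y.

Section LascarGroup.
Variables (K : Type) (L : language) (M : structure L) (e : hyperimaginary K M).

Lemma actM (I : Type) (f g : aut M) (C : set (I -> M)) :
  act (f * g) C = act f (act g C).
Proof. by rewrite /act image_comp. Qed.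

Lemma act1 (I : Type) (C : set (I -> M)) : act (1 : aut M) C = C.
Proof. by rewrite /act image_id. Qed.

Lemma fixing_group : group_closed [in fixing e].
Proof.
split; first by apply/mem_set; exact: act1.
move=> f g /set_mem fe /set_mem ge; apply/mem_set.
have gVe : act g^-1 (hi_class e) = hi_class e.
  by rewrite -[in LHS]ge -actM mulVg act1.
by rewrite /fixing /= actM gVe.
Qed.

Definition Aut_e : Type := set_type (fixing e).
HB.instance Definition _ := SubChoice.on Aut_e.
HB.instance Definition _ :=
  SubChoice_isSubGroup.Build (aut M) [in fixing e] Aut_e fixing_group.

Definition Autf_gen : set Aut_e :=
  [set f | exists A : model_over e, fixing_pointwise A (val f)].

Definition Autf_e : set Aut_e :=
  smallest (fun G : set Aut_e => group_closed [in G]) Autf_gen.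

Lemma Autf_group : group_closed [in Autf_e].
Proof.
split; first by apply/mem_set => G [[/set_mem G1 _] _].
move=> f g /set_mem Hf /set_mem Hg; apply/mem_set => G GP.
have [[_ Gdiv] _] := GP.
by apply/set_mem/Gdiv; apply/mem_set; [apply: Hf | apply: Hg].
Qed.

Lemma Autf_1 : Autf_e 1.
Proof. by have [/set_mem] := Autf_group. Qed.

Lemma Autf_V f : Autf_e f -> Autf_e f^-1.
Proof. by move=> /mem_set /(group_closedV Autf_group) /set_mem. Qed.

Lemma Autf_M f g : Autf_e f -> Autf_e g -> Autf_e (f * g).
Proof.
by move=> /mem_set Hf /mem_set Hg; apply/set_mem/(group_closedM Autf_group).
Qed.

Section ImageModel.
Variables (g : aut M) (A : set M).

Lemma image_memP (a : A) : g (val a) \in g @` A.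
Proof. by apply/mem_set; exists (val a) => //; exact: set_valP. Qed.

Lemma preimage_memP (b : set_type (g @` A)) : aut_inv g (val b) \in A.
Proof.
by apply/mem_set; case: (set_valP b) => a Aa <-; rewrite aut_funK.
Qed.

Definition to_image (a : A) : set_type (g @` A) :=
  exist _ (g (val a)) (image_memP a).
Definition of_image (b : set_type (g @` A)) : A :=
  exist _ (aut_inv g (val b)) (preimage_memP b).

Lemma to_imageK : cancel to_image of_image.
Proof. by move=> a; apply: val_inj; rewrite /= aut_funK. Qed.
Lemma of_imageK : cancel of_image to_image.
Proof. by move=> a; apply: val_inj; rewrite /= aut_invK. Qed.

Lemma elementary_image :
  elementary_substructure A -> elementary_substructure (g @` A).
Proof.
move=> [A_inh [fA [rA elA]]].
have B_inh : inhabited (g @` A) by have [a] := A_inh; exact: (inhabits (to_image a)).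
exists B_inh, (fun f xs => to_image (fA f (of_image \o xs))),
  (fun r xs => rA r (of_image \o xs)) => V phi v.
have -> : (fun x => val (v x)) = g \o (fun x => val (of_image (v x))) :> (V -> M).
  by apply/funext => x /=; rewrite aut_invK.
rewrite (sat_iso (aut_funK g) (aut_invK g)) //; last 2 first.
- exact: aut_fint.
- exact: aut_rint.
rewrite -(elA V phi (of_image \o v)).
apply: iff_sym.
set NA := Structure A_inh fA rA; set NB := Structure B_inh _ _.
apply: (@sat_iso L NB NA of_image to_image of_imageK to_imageK) => //.
by move=> f x /=; rewrite to_imageK.
Qed.

End ImageModel.

Lemma Autf_conj f g : Autf_e f -> Autf_e (f ^ g).
Proof.
move: f g; suff H : Autf_e `<=` [set f | forall g, Autf_e (f ^ g)].
  by move=> f g /H /(_ g).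
apply: smallest_sub => /=.
  split; first by apply/mem_set => h; rewrite (conj1g h); exact: Autf_1.
  move=> f1 f2 /set_mem H1 /set_mem H2; apply/mem_set => h /=.
  by rewrite conjMg conjVg; apply: Autf_M; [|apply: Autf_V]; [exact: H1|exact: H2].
move=> f0 [A fA] h; apply: sub_gen_smallest.
pose k : aut M := val (h^-1 : Aut_e).
have AS : small K (k @` A).
  have [le nge] := mo_small A; split.
    exact: card_le_trans (card_image_le _ _) le.
  by move=> ge; apply: nge; exact: card_le_trans ge (card_image_le _ _).
have kE : k = (val h)^-1 by [].
have hk : val h * k = 1 by rewrite kE mulgV.
have hfix : fixing e (val h) := set_valP h.
have kfix : fixing e k := set_valP (h^-1 : Aut_e).
have dclA : in_dcl_set e (k @` A).
  move=> f fkA; have fA' : fixing e (k^-1 * f * k).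
    apply: (mo_dcl (m := A)) => a Aa /=; rewrite fkA; last by exists a.
    exact: (aut_funK k a).
  have -> : f = k * (k^-1 * f * k) * k^-1 by rewrite !mulgA mulgV mul1g mulgK.
  have := fixing_group; move=> [_ fd]; apply/set_mem/(fd (k * _)); last exact/mem_set.
  by apply: (group_closedM fixing_group); exact/mem_set.
exists (ModelOver AS (elementary_image k (mo_elementary A)) dclA).
move=> _ [a Aa <-].
have -> : val (f0 ^ h) (k a) = k (val f0 ((val h * k) a)) by [].
by rewrite hk fA.
Qed.

Definition gal_rel (f g : Aut_e) : bool := `[< Autf_e (f^-1 * g) >].

Lemma gal_rel_refl : reflexive gal_rel.
Proof. by move=> f; apply/asboolP; rewrite mulVg; exact: Autf_1. Qed.

Lemma gal_rel_sym : symmetric gal_rel.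
Proof.
by move=> f g; apply/asboolP/asboolP => /Autf_V; rewrite invgM invgK.
Qed.

Lemma gal_rel_trans : transitive gal_rel.
Proof.
move=> g f h /asboolP H1 /asboolP H2; apply/asboolP.
have -> : f^-1 * h = (f^-1 * g) * (g^-1 * h) by rewrite !mulgA mulgK.
exact: Autf_M.
Qed.

Canonical gal_equiv := EquivRel gal_rel gal_rel_refl gal_rel_sym gal_rel_trans.

Definition Gal_L : Type := {eq_quot gal_equiv}.
HB.instance Definition _ := EqQuotient.on Gal_L.
HB.instance Definition _ := Choice.on Gal_L.

Definition gal_pi (f : Aut_e) : Gal_L := \pi_Gal_L f.

Lemma gal_piP f g : gal_pi f = gal_pi g <-> Autf_e (f^-1 * g).
Proof.
rewrite /gal_pi; split; first by move/eqmodP/asboolP.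
by move=> fg; apply/eqmodP/asboolP.
Qed.

Definition gal_mul (x y : Gal_L) : Gal_L := gal_pi (repr x * repr y).
Definition gal_inv (x : Gal_L) : Gal_L := gal_pi (repr x)^-1.

Lemma repr_gal_pi f : Autf_e (f^-1 * repr (gal_pi f)).
Proof. by apply/gal_piP; rewrite /gal_pi reprK. Qed.

Lemma gal_piM f g : gal_mul (gal_pi f) (gal_pi g) = gal_pi (f * g).
Proof.
apply/esym/gal_piP.
set f' := repr _; set g' := repr _.
have -> : (f * g)^-1 * (f' * g') = (f^-1 * f') ^ g * (g^-1 * g').
  by rewrite /conjg invgM !mulgA mulgK.
by apply: Autf_M; [apply: Autf_conj|]; exact: repr_gal_pi.
Qed.

Lemma gal_piV f : gal_inv (gal_pi f) = gal_pi f^-1.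
Proof.
apply/gal_piP; set f' := repr _; rewrite invgK.
have -> : f' * f^-1 = (f^-1 * f') ^ f^-1 by rewrite /conjg invgK !mulgA mulgV mul1g.
by apply: Autf_conj; exact: repr_gal_pi.
Qed.

Lemma gal_pi_surj x : exists f, x = gal_pi f.
Proof. by exists (repr x); rewrite /gal_pi reprK. Qed.

Lemma gal_mulA : associative gal_mul.
Proof.
move=> x y z.
have [f ->] := gal_pi_surj x; have [g ->] := gal_pi_surj y.
have [h ->] := gal_pi_surj z; by rewrite !gal_piM mulgA.
Qed.

Lemma gal_mul1 : left_id (gal_pi 1) gal_mul.
Proof. by move=> x; have [f ->] := gal_pi_surj x; rewrite gal_piM mul1g. Qed.

Lemma gal_mulr1 : right_id (gal_pi 1) gal_mul.
Proof. by move=> x; have [f ->] := gal_pi_surj x; rewrite gal_piM mulg1. Qed.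

Lemma gal_mulV : left_inverse (gal_pi 1) gal_inv gal_mul.
Proof.
by move=> x; have [f ->] := gal_pi_surj x; rewrite gal_piV gal_piM mulVg.
Qed.

Lemma gal_mulrV : right_inverse (gal_pi 1) gal_inv gal_mul.
Proof.
by move=> x; have [f ->] := gal_pi_surj x; rewrite gal_piV gal_piM mulgV.
Qed.

HB.instance Definition _ :=
  isGroup.Build Gal_L gal_mulA gal_mul1 gal_mulr1 gal_mulV gal_mulrV.

Section Topology.
Variables A B : model_over e.

(* [S_A(B)]; its elements are types in variables indexed by [A]. *)
Definition type_space : set (complete_type B A) :=
  [set tp B (fun a : A => f (val a)) | f in fixing e].

Lemma type_spaceP (p : type_space) :
  exists f : Aut_e, val p = tp B (fun a : A => val f (val a)).
Proof.
have [f /mem_set fe fp] := set_valP p.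
by exists (exist _ f fe); rewrite -[LHS]fp.
Qed.

(* The map [tp(f(A)/B) |-> gal_pi f]. An [f] representing the type [p] is
   chosen; when [M] is a monster model, [gal_pi f] does not depend on it. *)
Definition nu (p : type_space) : Gal_L := gal_pi (sval (cid (type_spaceP p))).

Definition gal_open (U : set Gal_L) : Prop := open (nu @^-1` U).

Lemma gal_openT : gal_open setT.
Proof. by rewrite /gal_open preimage_setT; exact: openT. Qed.
Lemma gal_openI : setI_closed gal_open.
Proof. by move=> U V oU oV; exact: openI. Qed.
Lemma gal_open_bigU (J : Type) (U : J -> set Gal_L) :
  (forall j, gal_open (U j)) -> gal_open (\bigcup_j U j).
Proof. by move=> oU; rewrite /gal_open preimage_bigcup; apply: bigcup_open => j _; exact: oU. Qed.

End Topology.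

Definition Gal_top (A B : model_over e) : Type := Gal_L.
HB.instance Definition _ (A B : model_over e) := Choice.on (Gal_top A B).
HB.instance Definition _ (A B : model_over e) :=
  isOpenTopological.Build (Gal_top A B) (gal_openT A B) (@gal_openI A B)
    (@gal_open_bigU A B).

Definition gal_closed (A B : model_over e) (H' : set Gal_L) : Prop :=
  closed (H' : set (Gal_top A B)).

Lemma Gal_top_openE (A B : model_over e) (U : set (Gal_top A B)) :
  open U = open (@nu A B @^-1` U).
Proof. by []. Qed.

End LascarGroup.

Arguments type_space {K L M e} A B.
Arguments nu {K L M e} A B p.
Arguments gal_pi {K L M e} f.
Arguments gal_closed {K L M e} A B H'.

(* Main.v *)
From Stdlib Require Import RelationClasses.
Require Import Defs.
From mathcomp Require Import all_boot.
From mathcomp Require Import finmap all_classical topology.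

Set Implicit Arguments.
Unset Strict Implicit.
Unset Printing Implicit Defensive.

Local Open Scope classical_set_scope.
Local Open Scope card_scope.
Local Open Scope group_scope.

(** The group [H] is the stabilizer of a hyperimaginary. Index tuples by the
model [A] and let [z ~ z'] hold when [z = z'], or when [z] and [z'] are the
images of (the enumeration of) [A] under automorphisms [k] and [k'] with
[k^-1 * k'] in [H]. Since every automorphism fixing [A] pointwise lies in [H],
this is an equivalence relation: its classes on the conjugates of [A] are the
left cosets of [H]. Let [e'] be the class of [A]. An automorphism fixes [e'] iff
it lies in [H] ([fixing_coset_hyperimaginary]), and the elements of [H] fix [e];
so the orbit equivalence relation of [H] is conjugacy over [e'] and [e].

The point is that [~] is type-definable without parameters, and this is where
closedness enters. The class of [f] in the Galois group depends only on the type
of [f(A)] over [B], so a closed subset of the group is cut out by a set of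
formulas: there is a type-definable [Q(x, y)] such that [f] is in [H] iff [f]
fixes [e] and [Q(f(A), B)] holds ([pdef_closed]). Applying [k], the condition
that [k^-1 * k'] be in [H] becomes [Q(k'(A), k(B))] together with
[k(e) = k'(e)]. Thus, for [e = r/E], tuples [z] and [z'] satisfy the second
clause iff there are [y], [u] and [u'] such that [(z, y, u)] realizes the type
of [(A, B, r)], [(z', u')] realizes the type of [(A, r)], and [E(u, u')] and
[Q(z', y)] hold ([pdef_coset_eq]). Homogeneity turns realizations back into
automorphisms, and saturation in small tuples of variables shows that a
type-definable condition remains so after an existential quantification over
[y], [u] and [u'] ([pdef_exists]).

The same argument shows that conjugacy over any hyperimaginary is type-definable
([type_definable_conjugacy]). Boundedness, both of the orbit of [e'] and of the
orbit equivalence relation, comes from counting types over a small model: tuples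
with the same type over [A] are conjugate by an element of [H], and there is
only a small number of types because there is only a small number of
formulas. *)

(** * Renaming, conjunctions and existential quantifiers *)

Section Formulas.
Variable L : language.

Fixpoint trename (V W : Type) (s : V -> W) (t : term L V) : term L W :=
  match t with
  | Var x => Var L (s x)
  | App f ts => App (fun i => trename s (ts i))
  end.

Fixpoint frename (V : Type) (phi : formula L V) :
    forall W : Type, (V -> W) -> formula L W :=
  match phi with
  | Bot => fun _ _ => Bot
  | Eq t u => fun _ s => Eq (trename s t) (trename s u)
  | Rel r ts => fun _ s => Rel (fun i => trename s (ts i))
  | Imp p q => fun _ s => Imp (frename p s) (frename q s)
  | All p => fun _ s => All (frename p (omap s))
  end.

Variable M : structure L.

Lemma eval_rename (V W : Type) (s : V -> W) (v : W -> M) (t : term L V) :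
  Defs.eval v (trename s t) = Defs.eval (v \o s) t.
Proof. by elim: t => //= f ts IH; congr fint; apply/funext => i. Qed.

Lemma sat_rename (V W : Type) (phi : formula L V) (s : V -> W) (v : W -> M) :
  sat (frename phi s) v <-> sat phi (v \o s).
Proof.
elim: phi W s v => {V} [V|V t u|V r ts|V p IHp q IHq|V p IHp] W s v //=.
- by rewrite !eval_rename.
- suff -> : (fun i => Defs.eval v (trename s (ts i))) =
    (fun i => Defs.eval (v \o s) (ts i)) by [].
  by apply/funext => i; rewrite eval_rename.
- by rewrite IHp IHq.
- split=> H m; [have /IHp := H m|apply/IHp; have := H m]; congr sat;
    by apply/funext => -[].
Qed.

Definition And (V : Type) (p q : formula L V) := Neg (Imp p (Neg q)).
Definition Or (V : Type) (p q : formula L V) := Imp (Neg p) q.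
Definition Ex (V : Type) (p : formula L (option V)) := Neg (All (Neg p)).

Lemma sat_and (V : Type) (p q : formula L V) (v : V -> M) :
  sat (And p q) v <-> sat p v /\ sat q v.
Proof.
split=> /= [|[? ?]]; last by tauto.
by case: (EM (sat p v)); case: (EM (sat q v)); tauto.
Qed.

Lemma sat_or (V : Type) (p q : formula L V) (v : V -> M) :
  sat (Or p q) v <-> sat p v \/ sat q v.
Proof. by rewrite /=; case: (EM (sat p v)); tauto. Qed.

Lemma sat_ex (V : Type) (p : formula L (option V)) (v : V -> M) :
  sat (Ex p) v <-> exists m, sat p (fun o => if o is Some x then v x else m).
Proof.
split=> /= [H|[m pm] H]; last exact: H pm.
by apply: contrapT => N; apply: H => m pm; apply: N; exists m.
Qed.

Lemma finite_conj (V : Type) (D : set (formula L V)) : finite_set D ->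
  exists phi : formula L V,
    forall v : V -> M, sat phi v <-> forall psi, D psi -> sat psi v.
Proof.
move=> /finite_seqP[s ->]; elim: s => [|psi s [phi IH]].
  by exists (Neg Bot) => v; split=> [_ psi|_ []].
exists (And psi phi) => v; rewrite sat_and IH; split.
  by move=> [pv sv] chi /=; rewrite in_cons => /predU1P[->//|/sv].
by move=> H; split=> [|chi cs]; apply: H; rewrite /= in_cons ?eqxx // cs orbT.
Qed.

Lemma eval_support (V : Type) (t : term L V) :
  exists S : set V, finite_set S /\
    forall v v' : V -> M,
      (forall x, S x -> v x = v' x) -> Defs.eval v t = Defs.eval v' t.
Proof.
elim: t => [x|f ts IH].
  by exists [set x]; split=> // v v' /= ->.
have [S HS] := choice IH.
exists (\bigcup_(i in setT) S i); split.
  by apply: bigcup_finite => [|i _]; [exact: finite_finset|case: (HS i)].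
move=> v v' E /=; congr fint; apply/funext => i.
by have [_] := HS i; apply=> x Sx; apply: E; exists i.
Qed.

(** Formulas are finite even though their variables may range over an infinite
type; this finiteness is what makes unions of chains harmless in the proof of
[saturated_tuple]. *)
Lemma sat_support (V : Type) (phi : formula L V) :
  exists S : set V, finite_set S /\
    forall v v' : V -> M,
      (forall x, S x -> v x = v' x) -> sat phi v -> sat phi v'.
Proof.
elim: phi => {V}
  [V|V t u|V r ts|V p [S [fS IHp]] q [S' [fS' IHq]]|V p [S [fS IHp]]].
- by exists set0; split.
- have [S [fS HS]] := eval_support t; have [S' [fS' HS']] := eval_support u.
  exists (S `|` S'); split; first by rewrite finite_setU.
  by move=> v v' E /=; rewrite (HS v v') ?(HS' v v') // => x Sx; apply: E;
    [right|left].
- have [S HS] := choice (fun i => eval_support (ts i)).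
  exists (\bigcup_(i in setT) S i); split.
    by apply: bigcup_finite => [|i _]; [exact: finite_finset|case: (HS i)].
  move=> v v' E /=; congr rint; apply/funext => i.
  by have [_] := HS i; apply=> x Sx; apply: E; exists i.
- exists (S `|` S'); split; first by rewrite finite_setU.
  move=> v v' E /= H pv'; apply: (IHq v) => [x Sx|]; first by apply: E; right.
  by apply: H; apply: (IHp v') => // x Sx; rewrite E //; left.
- exists (Some @^-1` S); split.
    by apply: finite_preimage => // x y _ _ [].
  move=> v v' E /= H m; apply: IHp (H m) => -[x|//] Sx; exact: E.
Qed.

(** The variables of [s] are bound one at a time: the bound variable replaces
[j], which leaves a formula depending on fewer variables of [J]. The hypothesis
says that only the variables in [s] remain to be bound. *)
Lemma sat_exists_seq (J : eqType) (V : Type) (s : seq J)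
    (phi : formula L (J + V)) :
  (forall (v : V -> M) z z', (forall j, j \in s -> z j = z' j) ->
     sat phi (tcat z v) -> sat phi (tcat z' v)) ->
  exists psi : formula L V,
    forall v : V -> M, sat psi v <-> exists z, sat phi (tcat z v).
Proof.
elim: s phi => [|j s IH] phi H.
  (* [phi] no longer depends on [J], but [V] may be empty, so the variables of
     [J] are all sent to a single fresh bound variable. *)
  pose s (x : J + V) := if x is inr y then Some y else None.
  exists (Ex (frename phi s)) => v; rewrite sat_ex; split.
    move=> [m /sat_rename pm]; exists (fun=> m); move: pm; congr sat.
    by apply/funext => -[].
  have [m] := carrier_inhabited M.
  move=> [z pz]; exists m; apply/sat_rename; have := H v z (fun=> m) _ pz.
  have -> : tcat (fun=> m) v =
      (fun o => if o is Some x then v x else m) \o s by apply/funext => -[].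
  exact.
pose t (x : J + V) :=
  if x is inl i then if i == j then None else Some x else Some x.
pose upd (z : J -> M) m i := if i == j then m else z i.
have updE z (v : V -> M) m : tcat (upd z m) v =
    (fun o => if o is Some x then tcat z v x else m) \o t.
  by apply/funext => -[i|]//=; rewrite /upd; case: eqP.
have phi1E z (v : V -> M) : sat (Ex (frename phi t)) (tcat z v) <->
    exists m, sat phi (tcat (upd z m) v).
  by rewrite sat_ex; split=> -[m pm]; exists m; move: pm;
    rewrite sat_rename updE.
have [v z z' E|psi psiE] := IH (Ex (frename phi t)).
  move=> /phi1E[m pm]; apply/phi1E; exists m; apply: H pm => i.
  by rewrite inE /upd; case: eqP => //= _ /E.
exists psi => v; rewrite psiE; split.
  by move=> [z /phi1E[m pm]]; exists (upd z m).
move=> [z pz]; exists z; apply/phi1E; exists (z j).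
move: pz; congr (sat _ (tcat _ _)); apply/funext => i.
by rewrite /upd; case: eqP => [->|].
Qed.

(** A formula involves finitely many variables, so quantifying over an infinite
tuple of variables is expressible by a single formula. *)
Lemma sat_exists (J V : Type) (phi : formula L (J + V)) :
  exists psi : formula L V,
    forall v : V -> M, sat psi v <-> exists z : J -> M, sat phi (tcat z v).
Proof.
have [S [fS HS]] := sat_support phi.
have fJ : finite_set (inl @^-1` S : set {classic J}).
  by apply: finite_preimage => // x y _ _ [].
have [s sE] := (finite_seqP _).1 fJ.
apply: (@sat_exists_seq {classic J} V s) => v z z' E; apply: HS => -[j Sj|//].
apply: E; have : (inl @^-1` S : set {classic J}) j by [].
by rewrite sE.
Qed.

End Formulas.

(** * Small cardinals *)

Section Cardinals.

Lemma card_le_inj (X Y : Type) (f : X -> Y) :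
  injective f -> [set: X] #<= [set: Y].
Proof.
move=> fI; have /card_leP[g] : [set: X] #<= f @` [set: X].
  by rewrite (card_le_eqr (inj_card_eq _)) // => x y _ _ /fI.
by apply: card_le_trans (subset_card_le _); [apply/card_leP; squash g|].
Qed.

(** Comparability of cardinals: a maximal partial injection is total or onto. *)
Lemma inj_total (X Y : Type) :
  (exists f : X -> Y, injective f) \/ (exists f : Y -> X, injective f).
Proof.
pose P (G : set (X * Y)) := forall p q, G p -> G q -> p.1 = q.1 <-> p.2 = q.2.
have [|G [PG Gmax]] := @Zorn_bigcup _ P.
  move=> F FP Ftot p q [G FG Gp] [G' FG' Gq].
  by have [/(_ _ Gp) Gp'|/(_ _ Gq) Gq'] := Ftot _ _ FG FG';
    [apply: (FP _ FG')|apply: (FP _ FG)].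
have [domG|/existsNP[x Nx]] := EM (forall x, exists y, G (x, y)).
  have [f Gf] := choice domG; left; exists f => x y E.
  by have /PG/(_ (Gf y))/= -> := Gf x.
have [ranG|/existsNP[y Ny]] := EM (forall y, exists x, G (x, y)).
  have [f Gf] := choice ranG; right; exists f => z y E.
  by have /PG/(_ (Gf y))/= <- := Gf z.
exfalso; apply: (Gmax (G `|` [set (x, y)])).
  split; first by left.
  by move=> GG; apply: Nx; exists y; apply: GG; right.
move=> [x1 y1] [x2 y2] [G1|[-> ->]] [G2|[-> ->]] //=; first exact: PG G1 G2.
- by split=> E; [case: Nx; exists y1|case: Ny; exists x1]; rewrite -E.
- by split=> E; [case: Nx; exists y2|case: Ny; exists x2]; rewrite E.
Qed.

Variable K : Type.
Hypothesis KL : uncountable_strong_limit K.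

Lemma small_card_le (X Y : Type) (A : set X) (B : set Y) :
  A #<= B -> small K B -> small K A.
Proof.
move=> AB [BK KB]; split; first exact: card_le_trans BK.
by move=> KA; apply: KB; exact: card_le_trans AB.
Qed.

Lemma small_inj (X Y : Type) (f : X -> Y) :
  injective f -> small K [set: Y] -> small K [set: X].
Proof. by move=> fI; apply: small_card_le; exact: card_le_inj fI. Qed.

Lemma small_setT (X : Type) (A : set X) : small K A -> small K [set: A].
Proof.
by apply: small_card_le; rewrite (card_le_eqr (card_setT_sym A)) card_lexx.
Qed.

Lemma small_image (X Y : Type) (f : X -> Y) (A : set X) :
  small K A -> small K (f @` A).
Proof. by apply: small_card_le; exact: card_image_le. Qed.

Lemma small_pow (X : Type) : small K [set: X] -> small K [set: set X].
Proof. exact: KL.2. Qed.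

Lemma small_nat : small K [set: nat]. Proof. exact: KL.1. Qed.

(** Two iterated power sets leave room for two disjoint copies of [Y], whatever
the size of [Y]: distinct points have distinct singletons, and adding [set0] as
an element marks the second copy. *)
Lemma small_double (Y : Type) :
  small K [set: Y] -> small K [set: Y + Y].
Proof.
move=> SY; pose f (s : Y + Y) : set (set Y) := match s with
  | inl y => [set [set y]] | inr y => [set [set y]] `|` [set set0] end.
have ne (y : Y) : [set y] <> set0.
  by move=> E; have : [set y] y by []; rewrite E.
have fE y z : f (inl y) = f (inr z) -> False.
  move=> E; have : f (inr z) set0 by right.
  by rewrite -E => /= /esym/ne.
apply: (small_inj (f := f)) (small_pow (small_pow SY)) => -[y|y] [z|z] // E;
  try by [case: (fE _ _ E) | case: (fE _ _ (esym E))].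
  have : f (inl y) [set y] by [].
  rewrite E => /= /seteqP[/(_ y erefl) + _]; by move=> ->.
have : f (inr y) [set y] by left.
by rewrite E => -[|/ne//] /= /seteqP[/(_ y erefl) + _]; move=> ->.
Qed.

Lemma small_sum (X Y : Type) :
  small K [set: X] -> small K [set: Y] -> small K [set: X + Y].
Proof.
move=> SX SY; have [[f fI]|[f fI]] := inj_total X Y.
  pose g (s : X + Y) : Y + Y :=
    match s with inl x => inl (f x) | inr y => inr y end.
  apply: (small_inj (f := g)) (small_double SY).
  by move=> [x|x] [y|y] // [] => [/fI|] ->.
pose g (s : X + Y) : X + X :=
  match s with inl x => inl x | inr y => inr (f y) end.
apply: (small_inj (f := g)) (small_double SX).
by move=> [x|x] [y|y] // [] => [|/fI] ->.
Qed.

Lemma small_prod (X Y : Type) :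
  small K [set: X] -> small K [set: Y] -> small K [set: X * Y].
Proof.
move=> SX SY.
pose g (p : X * Y) : set (X + Y) := [set s | s = inl p.1 \/ s = inr p.2].
apply: (small_inj (f := g)) (small_pow (small_sum SX SY)).
move=> [x y] [x' y'] /seteqP[H _].
have /= [|[->]|] := H (inl x); [by left| |by []].
by have /= [|//|[->]] := H (inr y); first by right.
Qed.

Lemma small_count (X : countType) : small K [set: X].
Proof. exact: small_inj (pcan_inj choice.pickleK) small_nat. Qed.

End Cardinals.

(** * Counting formulas *)

Section FormulaCount.
Variable L : language.

(** A term or formula is coded by the set of pairs of a position and the label
of its syntax tree at this position; this turns the nested types of terms and
formulas into a subset of a fixed type, with a straightforward injectivity. *)
Definition tree (S : Type) : Type := set (seq nat * S).
Definition node (S : Type) (l : S) (c : nat -> tree S) : tree S :=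
  fun q => if q.1 is i :: p then c i (p, q.2) else q.2 = l.
Definition branches (S : Type) (n : nat) (g : 'I_n -> tree S) (i : nat) :
    tree S :=
  fun q => exists j : 'I_n, i = j /\ g j q.
Definition branch2 (S : Type) (a b : tree S) (i : nat) : tree S :=
  if i is 0 then a else b.

Lemma node_inj (S : Type) (l l' : S) c c' :
  node l c = node l' c' -> l = l' /\ c = c'.
Proof.
move=> E; split; first by have : node l c ([::], l) by []; rewrite E.
apply/funext => i; apply/funext => -[p s].
exact: (congr1 (fun t : tree S => t (i :: p, s)) E).
Qed.

Lemma branches_inj (S : Type) (n : nat) (g g' : 'I_n -> tree S) :
  branches g = branches g' -> g = g'.
Proof.
move=> E; apply/funext => j; apply/funext => q; apply/propext.
have Ej : branches g j q = branches g' j q by rewrite E.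
split=> H.
- have : branches g j q by exists j.
  by rewrite Ej => -[k [/val_inj <-]].
- have : branches g' j q by exists j.
  by rewrite -Ej => -[k [/val_inj <-]].
Qed.

Lemma branch2_inj (S : Type) (a b a' b' : tree S) :
  branch2 a b = branch2 a' b' -> a = a' /\ b = b'.
Proof.
move=> E; split.
- exact: (congr1 (fun f => f 0%N) E).
- exact: (congr1 (fun f => f 1%N) E).
Qed.

Variable V0 : Type.

Inductive label := LVar of nat + V0 | LFun of fsymb L | LRel of rsymb L
  | LTag of nat.

(** The variables of a formula under [n] quantifiers are coded by [nat + V0]: de
Bruijn indices for the bound variables, the original variables for the
others. *)
Definition shift (V : Type) (rho : V -> nat + V0) (x : option V) : nat + V0 :=
  match x with
  | None => inl 0%N
  | Some v => match rho v with inl n => inl n.+1 | inr w => inr w end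
  end.

Lemma shift_inj (V : Type) (rho : V -> nat + V0) :
  injective rho -> injective (shift rho).
Proof.
move=> rI [x|] [y|] //=; last 2 first.
- by case: (rho x).
- by case: (rho y).
by case Ex: (rho x) => [n|w]; case Ey: (rho y) => [m|z] // [E];
  congr Some; apply: rI; rewrite Ex Ey E.
Qed.

Fixpoint tcode (V : Type) (rho : V -> nat + V0) (t : term L V) : tree label :=
  match t with
  | Var x => node (LVar (rho x)) (fun=> set0)
  | App f ts => node (LFun f) (branches (fun i => tcode rho (ts i)))
  end.

Fixpoint fcode (V : Type) (phi : formula L V) : (V -> nat + V0) -> tree label :=
  match phi with
  | Bot => fun _ => node (LTag 0) (fun=> set0)
  | Eq t u => fun rho => node (LTag 1) (branch2 (tcode rho t) (tcode rho u))
  | Rel r ts => fun rho => node (LRel r) (branches (fun i => tcode rho (ts i)))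
  | Imp p q => fun rho => node (LTag 2) (branch2 (fcode p rho) (fcode q rho))
  | All p => fun rho => node (LTag 3) (fun=> fcode p (shift rho))
  end.

Lemma tcode_inj (V : Type) (rho : V -> nat + V0) :
  injective rho -> injective (tcode rho).
Proof.
move=> rI t; elim: t => [x|f ts IH] [y|g us] /= E0;
  have [E1 E2] := node_inj E0; try discriminate E1.
  by case: E1 => /rI ->.
case: E1 => E1; subst g; move/branches_inj: E2 => E; congr App.
by apply/funext => i; apply: IH; exact: (congr1 (fun f => f i) E).
Qed.

Lemma fcode_inj (V : Type) (phi psi : formula L V) (rho : V -> nat + V0) :
  injective rho -> fcode phi rho = fcode psi rho -> phi = psi.
Proof.
elim: phi psi rho => {V} [V|V t u|V r ts|V p IHp q IHq|V p IHp]
  [|t' u'|r' ts'|p' q'|p'] rho rI /= E0;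
  have [E1 E2] := node_inj E0; try discriminate E1.
- by [].
- by move: E2 => /branch2_inj[/(tcode_inj rI) -> /(tcode_inj rI) ->].
- case: E1 => E1; subst r'; move/branches_inj: E2 => E; congr Rel.
  by apply/funext => i; apply: (tcode_inj rI); exact: (congr1 (fun f => f i) E).
- by move: E2 => /branch2_inj[/(IHp _ _ rI) -> /(IHq _ _ rI) ->].
- congr All; apply: (IHp _ _ (shift_inj rI)).
  exact: (congr1 (fun f => f 0%N) E2).
Qed.

Variables (K : Type) (KL : uncountable_strong_limit K).

Lemma small_formula : small K [set: fsymb L] -> small K [set: rsymb L] ->
  small K [set: V0] -> small K [set: formula L V0].
Proof.
move=> SF SR SV.
have SL : small K [set: label].
  pose f (l : label) : nat + V0 + fsymb L + rsymb L + nat := match l with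
    | LVar x => inl (inl (inl x)) | LFun s => inl (inl (inr s))
    | LRel s => inl (inr s) | LTag n => inr n end.
  apply: (small_inj (f := f)); first by move=> [x|x|x|x] [y|y|y|y] // [->].
  by repeat apply: (small_sum KL) => //; exact: (small_nat KL).
apply: (small_inj (f := fun phi : formula L V0 => fcode phi inr)).
  by move=> phi psi; apply: fcode_inj => x y [].
by apply/(small_pow KL)/(small_prod KL) => //; exact: (small_count KL).
Qed.

End FormulaCount.

(** * Saturation and homogeneity for small tuples *)

Section Tuples.
Variables (K : Type) (L : language) (M : structure L).
Hypotheses (KL : uncountable_strong_limit K) (MS : saturated K M)
  (MH : strongly_homogeneous K M).

(** Saturation with the parameters listed by an assignment [v], so that
variables and parameters can be exchanged by renaming. *)
Lemma saturated_assignment (V : Type) (v : V -> M)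
    (p : set (formula L (unit + V))) :
  small K [set: V] ->
  (forall D, finite_set D -> D `<=` p ->
     exists m : M, forall phi, D phi -> sat phi (tcat (fun=> m) v)) ->
  exists m : M, forall phi, p phi -> sat phi (tcat (fun=> m) v).
Proof.
move=> SV pfin; pose A := range v.
have vA x : v x \in A by apply/mem_set; exists x.
pose s (x : unit + V) : unit + A := match x with
  | inl u => inl u | inr x => inr (exist _ (v x) (vA x)) end.
have sE (x : unit -> M) : tcat x (val : A -> M) \o s = tcat (fun=> x tt) v.
  by apply/funext => -[[]|].
have sat_s phi (x : unit -> M) :
    sat_in (frename phi s) x <-> sat phi (tcat (fun=> x tt) v).
  by rewrite /sat_in sat_rename sE.
have [||x xP] := @MS A ((fun phi => frename phi s) @` p).
- exact: small_image.
- move=> D fD Dp.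
  have /choice[g gP] : forall psi : formula L (unit + A),
      exists phi, D psi -> p phi /\ frename phi s = psi.
    move=> psi; have [Dpsi|] := EM (D psi); last by exists Bot.
    by have [phi pphi <-] := Dp _ Dpsi; exists phi.
  have [||m mP] := pfin (g @` D); first exact: finite_image.
    by move=> _ [psi /gP[pg _] <-].
  exists (fun=> m) => psi Dpsi; have [_ <-] := gP _ Dpsi.
  by apply/sat_s/mP; exists psi.
by exists (x tt) => phi pphi; apply/sat_s/xP; exists phi.
Qed.

(** By Zorn's lemma there is a maximal partial assignment [G] of the variables
in [J] over which [p] is still finitely satisfiable. It is total: given a
variable [j0] outside its domain, saturation in one variable yields a value for
[j0] that keeps every finite part of [p] satisfiable, the other unassigned
variables being existentially quantified. *)
Lemma saturated_tuple (J V : Type) (v : V -> M)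
    (p : set (formula L (J + V))) :
  small K [set: J] -> small K [set: V] ->
  (forall D, finite_set D -> D `<=` p ->
     exists z : J -> M, forall phi, D phi -> sat phi (tcat z v)) ->
  exists z : J -> M, forall phi, p phi -> sat phi (tcat z v).
Proof.
move=> SJ SV pfin.
pose ext (G : set (J * M)) (z : J -> M) := forall j m, G (j, m) -> z j = m.
pose P (G : set (J * M)) := forall D, finite_set D -> D `<=` p ->
  exists2 z, ext G z & forall phi, D phi -> sat phi (tcat z v).
have [|G [PG Gmax]] := @Zorn_bigcup _ P.
  move=> F FP Ftot D fD Dp; set U := \bigcup_(X in F) X.
  have [F0|/set0P[G0 FG0]] := eqVneq F set0.
    have [z zD] := pfin D fD Dp.
    by exists z => // j m [G]; rewrite F0.
  have fn G : F G -> forall j m m', G (j, m) -> G (j, m') -> m = m'.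
    move=> FG j m m' Gm Gm'.
    have [|//|z zG _] := FP _ FG set0; first exact: finite_set0.
    by rewrite -(zG _ _ Gm) -(zG _ _ Gm').
  have [phi phiD] := finite_conj M fD.
  have [S [fS SP]] := sat_support M phi.
  have : finite_set (inl @^-1` S : set {classic J}).
    by apply: finite_preimage => // x y _ _ [].
  move=> /finite_seqP[s sE].
  (* Finitely many variables matter, so one member of the chain already assigns
     all those among them that [U] assigns. *)
  have [G FG Gs] : exists2 G, F G &
      forall j : {classic J}, j \in s -> forall m, U (j, m) -> G (j, m).
    elim: s {sE} => [|j s [G FG Gs]]; first by exists G0.
    have [[m [G' FG' Gm]]|N] := EM (exists m, U (j, m)); last first.
      exists G => // i; rewrite in_cons => /predU1P[->|/Gs//] m Um.
      by case: N; exists m.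
    have [G1 [FG1 G1G G1G']] : exists G1, [/\ F G1, G `<=` G1 & G' `<=` G1].
      by have [GG'|G'G] := Ftot _ _ FG FG'; [exists G'; split|exists G; split].
    exists G1 => // i; rewrite in_cons => /predU1P[->|/Gs Hi] m'; last first.
      by move=> /Hi/G1G.
    move=> [G2 FG2 Gm'].
    suff -> : m' = m by exact: G1G'.
    by have [/(_ _ Gm) ?|/(_ _ Gm') ?] := Ftot _ _ FG' FG2;
      [apply: (fn _ FG2 j)|apply: (fn _ FG' j)].
  have [z zG zD] := FP _ FG D fD Dp.
  have /choice[z' z'P] : forall j, exists m',
      (forall m, U (j, m) -> m' = m) /\
      (~ (exists m, U (j, m)) -> m' = z j).
    move=> j; have [[m Um]|N] := EM (exists m, U (j, m)).
      exists m; split=> [m' [G' FG' Gm']|[]]; last by exists m.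
      have [G1 FG1 Gm] := Um.
      by have [/(_ _ Gm) ?|/(_ _ Gm') ?] := Ftot _ _ FG1 FG';
        [apply: (fn _ FG' j)|apply: (fn _ FG1 j)].
    by exists (z j); split=> // m Um; case: N; exists m.
  exists z'; first by move=> j m; exact: (z'P j).1.
  apply/phiD; apply: (SP (tcat z v)); last exact/phiD.
  move=> [j Sj|//] /=.
  have js : (j : {classic J}) \in s.
    by have : (inl @^-1` S : set {classic J}) j by []; rewrite sE.
  have [[m Um]|N] := EM (exists m, U (j, m)).
    by rewrite (zG _ _ (Gs _ js _ Um)) ((z'P j).1 _ Um).
  by rewrite ((z'P j).2 N).
have [g gG _] : exists2 z, ext G z & forall phi, set0 phi -> sat phi (tcat z v).
  by apply: PG; [exact: finite_set0|].
have domG j0 : exists m, G (j0, m).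
  apply: contrapT => Nj0.
  suff [m PGm] : exists m, P (G `|` [set (j0, m)]).
    apply: Gmax PGm; split; first by left.
    by move=> GG; apply: Nj0; exists m; apply: GG; right.
  pose dom j := `[< exists m, G (j, m) >].
  (* The variable [j0] becomes the unknown, the variables assigned by [G] become
     parameters, and the variables left in [J] are those to be quantified. *)
  pose s (x : J + V) : J + (unit + (V + J)) := match x with
    | inl j => if `[< j = j0 >] then inr (inl tt)
               else if dom j then inr (inr (inr j)) else inl j
    | inr y => inr (inr (inl y)) end.
  pose ok (D : set (formula L (J + V))) m := exists2 z : J -> M,
    ext (G `|` [set (j0, m)]) z & forall phi, D phi -> sat phi (tcat z v).
  pose q : set (formula L (unit + (V + J))) := [set psi | exists D,
    [/\ finite_set D, D `<=` p &
        forall m, sat psi (tcat (fun=> m) (tcat v g)) <-> ok D m]].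
  have qD D : finite_set D -> D `<=` p -> exists2 psi, q psi &
      forall m, sat psi (tcat (fun=> m) (tcat v g)) <-> ok D m.
    move=> fD Dp; have [phi phiD] := finite_conj M fD.
    have [psi psiE] := sat_exists M (frename phi s).
    suff H m : sat psi (tcat (fun=> m) (tcat v g)) <-> ok D m.
      by exists psi => //; exists D.
    rewrite psiE; split.
      move=> [z]; rewrite sat_rename => zs.
      exists (fun j => if `[< j = j0 >] then m else if dom j then g j else z j).
        move=> j m' [Gm'|[-> ->]]; last by case: asboolP.
        case: asboolP => [E|_]; first by case: Nj0; exists m'; rewrite -E.
        by rewrite /dom; case: asboolP => [_|[]]; [exact: gG|exists m'].
      apply/phiD; move: zs; congr sat; apply/funext => -[j|//] /=.
      by case: asboolP => // _; case: (dom j).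
    move=> [z zG zD]; exists z; apply/sat_rename.
    have := (phiD (tcat z v)).2 zD; congr sat; apply/funext => -[j|//] /=.
    case: asboolP => [->|_] /=; first by apply: zG; right.
    rewrite /dom; case: asboolP => //= -[m' Gm'].
    by rewrite (gG _ _ Gm'); apply: zG; left.
  have [||m mq] := @saturated_assignment _ (tcat v g) q; first exact: small_sum.
    move=> Q fQ Qq.
    have /choice[h hP] : forall psi : formula L (unit + (V + J)), exists D,
        Q psi -> [/\ finite_set D, D `<=` p &
        forall m, sat psi (tcat (fun=> m) (tcat v g)) <-> ok D m].
      move=> psi; have [/Qq[D DP]|] := EM (Q psi); last by exists set0.
      by exists D.
    have [||z zG zD] := PG (\bigcup_(psi in Q) h psi).
    - by apply: bigcup_finite => // psi /hP[].
    - by move=> phi [psi /hP[_ +] _]; exact.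
    exists (z j0) => psi Qpsi; have [_ _ ->] := hP _ Qpsi.
    exists z => [j m [/zG//|[-> ->//]]|phi hphi].
    by apply: zD; exists psi.
  exists m => D fD Dp; have [psi qpsi psiE] := qD D fD Dp.
  exact/psiE/mq.
exists g => phi pphi.
have [||z zG zphi] := PG [set phi]; first exact: finite_set1.
  by move=> _ ->.
suff -> : g = z by exact: zphi.
by apply/funext => j; have [m Gm] := domG j; rewrite (gG _ _ Gm) (zG _ _ Gm).
Qed.

Lemma homogeneous_tuple (I : Type) (x y : I -> M) :
  small K [set: I] -> (forall phi, sat phi x <-> sat phi y) ->
  exists f : aut M, f \o x = y.
Proof.
move=> SI xy; pose A := range x.
have /choice[s sP] : forall a : A, exists i, x i = val a.
  move=> a; have /set_mem[i _ ia] := valP a; by exists i.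
have [||f fP] := @MH A (y \o s); first exact: small_image.
  move=> phi; rewrite -sat_rename -xy sat_rename.
  by have -> : x \o s = val by apply/funext => a /=.
exists f; apply/funext => i /=.
have xA : x i \in A by apply/mem_set; exists i.
rewrite (fP (exist _ (x i) xA)) /=.
have := xy (Eq (Var L (s (exist _ (x i) xA))) (Var L i)).
by rewrite /= sP /= => -[+ _]; exact.
Qed.

Lemma sat_aut (f : aut M) (V : Type) (phi : formula L V) (v : V -> M) :
  sat phi (f \o v) <-> sat phi v.
Proof.
apply: (sat_iso (aut_funK f) (aut_invK f)); [exact: aut_fint|exact: aut_rint].
Qed.

End Tuples.

(** * Type-definable conditions on tuples *)

Section TypeDefined.
Variables (L : language) (M : structure L).

Definition eqtp (V : Type) (x y : V -> M) :=
  forall phi, sat phi x <-> sat phi y.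

(** Type-definability without parameters of a condition on a single tuple.
Binary relations and parameters are obtained by splitting the index type. *)
Definition pdef (V : Type) (P : (V -> M) -> Prop) : Prop :=
  exists p : set (formula L V),
    forall v, P v <-> forall phi, p phi -> sat phi v.

Lemma pdef_ext (V : Type) (P Q : (V -> M) -> Prop) :
  (forall v, P v <-> Q v) -> pdef Q -> pdef P.
Proof. by move=> PQ [p pP]; exists p => v; rewrite PQ. Qed.

Lemma pdef_rename (V W : Type) (s : V -> W) (P : (V -> M) -> Prop) :
  pdef P -> pdef (fun w : W -> M => P (w \o s)).
Proof.
move=> [p pP]; exists ((fun phi => frename phi s) @` p) => w; rewrite pP; split.
  by move=> H _ [phi pphi <-]; apply/sat_rename/H.
by move=> H phi pphi; apply/sat_rename/H; exists phi.
Qed.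

Lemma pdef_and (V : Type) (P Q : (V -> M) -> Prop) :
  pdef P -> pdef Q -> pdef (fun v => P v /\ Q v).
Proof.
move=> [p pP] [q qQ]; exists (p `|` q) => v; rewrite pP qQ; split.
  by move=> [Hp Hq] phi [/Hp|/Hq].
by move=> H; split=> phi Hphi; apply: H; [left|right].
Qed.

Lemma pdef_or (V : Type) (P Q : (V -> M) -> Prop) :
  pdef P -> pdef Q -> pdef (fun v => P v \/ Q v).
Proof.
move=> [p pP] [q qQ].
exists [set chi | exists phi psi, [/\ p phi, q psi & chi = Or phi psi]] => v.
rewrite pP qQ; split.
  by move=> [H|H] _ [phi [psi [pphi qpsi ->]]]; apply/sat_or;
    [left|right]; exact: H.
move=> H; apply/or_asboolP; rewrite -implyNb; apply/implyP.
move=> /asboolP/existsNP[phi /not_implyP[pphi Nphi]]; apply/asboolP => psi qpsi.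
suff /H/sat_or[] : exists phi' psi', [/\ p phi', q psi' &
  Or phi psi = Or phi' psi'] by [].
by exists phi, psi.
Qed.

Lemma pdef_eq (I V : Type) (s t : I -> V) :
  pdef (fun v : V -> M => v \o s = v \o t).
Proof.
exists [set Eq (Var L (s i)) (Var L (t i)) | i in setT] => v; split.
  by move=> E _ [i _ <-] /=; exact: (congr1 (fun f => f i) E).
by move=> H; apply/funext => i; exact: (H _ (imageP _ _)).
Qed.

Lemma eqtp_of_imp (V : Type) (x y : V -> M) :
  (forall phi, sat phi x -> sat phi y) -> eqtp x y.
Proof.
move=> H phi; split; first exact: H.
by move=> py; apply: contrapT => Npx; exact: (H (Neg phi) Npx).
Qed.

Lemma pdef_eqtp_const (V : Type) (x : V -> M) : pdef (eqtp x).
Proof.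
exists [set phi | sat phi x] => v; split=> [xv phi /xv//|H].
exact: eqtp_of_imp.
Qed.

Lemma pdef_eqtp (I V : Type) (s t : I -> V) :
  pdef (fun v : V -> M => eqtp (v \o s) (v \o t)).
Proof.
exists [set Imp (frename phi s) (frename phi t) | phi in setT] => v; split.
  by move=> H _ [phi _ <-] /= /sat_rename/H/sat_rename.
move=> H; apply: eqtp_of_imp => phi /sat_rename ps.
by apply/sat_rename; apply: (H _ (imageP _ _)) ps.
Qed.

Variables (K : Type) (KL : uncountable_strong_limit K) (MS : saturated K M)
  (MH : strongly_homogeneous K M).

(** By saturation, a small tuple [z] satisfying a set of formulas over [v]
exists as soon as every finite part of that set is satisfiable over [v]; the
latter is expressed by the formulas that [sat_exists] provides. *)
Lemma pdef_exists (J V : Type) (P : (J + V -> M) -> Prop) :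
  small K [set: J] -> small K [set: V] -> pdef P ->
  pdef (fun v => exists z, P (tcat z v)).
Proof.
move=> SJ SV [p pP].
exists [set psi | exists D, [/\ finite_set D, D `<=` p & forall v : V -> M,
  sat psi v <-> exists z, forall phi, D phi -> sat phi (tcat z v)]] => v; split.
  move=> [z /pP H] psi [D [_ Dp ->]]; exists z => phi /Dp; exact: H.
move=> H; have [|z zp] := saturated_tuple KL MS SJ SV (v := v) (p := p).
  move=> D fD Dp; have [phi phiD] := finite_conj M fD.
  have [psi psiE] := sat_exists M phi.
  have psiD (w : V -> M) : sat psi w <->
      exists z, forall phi, D phi -> sat phi (tcat z w).
    by rewrite psiE; split=> -[z /phiD zD]; exists z.
  by apply/psiD; apply: H; exists D.
by exists z; apply/pP.
Qed.

Lemma eqtpP (I : Type) (x y : I -> M) :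
  small K [set: I] -> eqtp x y <-> exists f : aut M, y = f \o x.
Proof.
move=> SI; split=> [/(homogeneous_tuple MH SI)[f <-]|[f ->] phi].
  by exists f.
by rewrite sat_aut.
Qed.

Implicit Types F : tdequiv K M.

Lemma pdef_td F : pdef (fun v : td_idx F + td_idx F -> M =>
  F (v \o inl) (v \o inr)).
Proof.
have [p pF] := td_def F.
pose s (x : td_idx F + td_idx F + (set0 : set M)) : td_idx F + td_idx F :=
  match x with inl x => x | inr a => False_rect _ (set_valP a) end.
exists ((fun phi => frename phi s) @` p) => v.
have vE :
    tcat (tcat (v \o inl) (v \o inr)) (val : (set0 : set M) -> M) = v \o s.
  by apply/funext => -[[]|a] //; case: (set_valP a).
rewrite pF /sat_in vE; split.
  by move=> H _ [phi pphi <-]; apply/sat_rename/H.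
by move=> H phi pphi; apply/sat_rename/H; exists phi.
Qed.

Lemma pdef_aut (V : Type) (P : (V -> M) -> Prop) (f : aut M) (v : V -> M) :
  pdef P -> P (f \o v) <-> P v.
Proof.
by move=> [p pP]; rewrite !pP; split=> H phi /H; rewrite sat_aut.
Qed.

Lemma td_aut F (f : aut M) x y : F (f \o x) (f \o y) <-> F x y.
Proof. exact: (pdef_aut f (tcat x y) (pdef_td F)). Qed.

Lemma aut_compV (f : aut M) (I : Type) (x : I -> M) : f \o (aut_inv f \o x) = x.
Proof. by apply/funext => i /=; rewrite aut_invK. Qed.

(** Classes of an equivalence relation that is invariant under automorphisms are
compared through representatives. *)
Lemma act_eqclass F (f : aut M) (x y : real_tuple F) :
  act f (eqclass x) = eqclass y <-> F (f \o x) y.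
Proof.
have [refl sym trans] := td_equiv F; split.
  move=> /seteqP[+ _] => /(_ (f \o x))/= H; apply: sym; apply: H.
  by exists x => //; exact: refl.
move=> xy; apply/seteqP; split=> [_ [z xz <-]|w yw].
  by apply: trans (sym _ _ xy) _; apply/td_aut.
exists (aut_inv f \o w); last exact: aut_compV.
by apply/(td_aut f); rewrite aut_compV; exact: trans yw.
Qed.

Lemma fixingE (c : hyperimaginary K M) (f : aut M) :
  fixing c f <-> hi_eq c (f \o hi_rep c) (hi_rep c).
Proof. exact: act_eqclass. Qed.

Lemma orbit_eqE (G : set (aut M)) F (x y : real_tuple F) :
  orbit_eq G F x y <-> exists2 f, G f & F (f \o x) y.
Proof. by split=> -[f Gf] /act_eqclass fxy; exists f. Qed.

(** Let [c = r/E]. By homogeneity, [x_F] and [y_F] are conjugate over [c] iff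
there are [z] and [w] such that [(z, w)] has the type of [(r, x)], [E(z, r)] and
[F(w, y)]: then [z] and [w] are the images of [r] and [x] under an automorphism
that fixes [c]. *)
Lemma type_definable_conjugacy (c : hyperimaginary K M) F :
  type_definable K (orbit_eq (fixing c) F).
Proof.
set I := td_idx (hi_eq c); set X := td_idx F.
pose r : I -> M := hi_rep c.
have Sr : small K (range r).
  by apply: small_image; exact: td_small.
exists (range r) => //.
have rA i : r i \in range r by apply/mem_set; exists i.
pose s i : range r := exist _ (r i) (rA i).
pose V : Type := (X + X) + range r.
have SV : small K [set: V].
  apply: (small_sum KL); last exact: small_setT.
  by apply: (small_sum KL); exact: td_small.
have SJ : small K [set: I + X] by apply: (small_sum KL); exact: td_small.
pose s1 (i : I + X) : (I + X) + V := match i with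
  | inl i => inr (inr (s i)) | inr x => inr (inl (inl x)) end.
pose s2 (i : I + I) : (I + X) + V := match i with
  | inl i => inl (inl i) | inr i => inr (inr (s i)) end.
pose s3 (i : X + X) : (I + X) + V := match i with
  | inl i => inl (inr i) | inr i => inr (inl (inr i)) end.
have [p pP] : pdef (fun v : V -> M => exists z : I + X -> M,
    eqtp (tcat z v \o s1) (tcat z v \o inl) /\
    (hi_eq c (tcat z v \o s2 \o inl) (tcat z v \o s2 \o inr) /\
     F (tcat z v \o s3 \o inl) (tcat z v \o s3 \o inr))).
  apply: (pdef_exists (P := fun w => eqtp (w \o s1) (w \o inl) /\
    (hi_eq c (w \o s2 \o inl) (w \o s2 \o inr) /\
     F (w \o s3 \o inl) (w \o s3 \o inr)))) => //.
  apply: pdef_and; first exact: pdef_eqtp.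
  by apply: pdef_and; [exact: (pdef_rename s2 (pdef_td _))|
    exact: (pdef_rename s3 (pdef_td _))].
exists p => x y; rewrite /sat_in -pP orbit_eqE.
set v : V -> M := tcat (tcat x y) _.
have v1 z : tcat z v \o s1 = tcat r x by apply/funext => -[].
split.
  move=> [f /fixingE fc fxy]; exists (f \o tcat r x); split.
    by rewrite v1; apply/eqtpP => //; exists f.
  split; first exact: fc.
  exact: fxy.
move=> [z []]; rewrite v1 => /eqtpP[//|f fz] [zc zF].
have zE : z = f \o tcat r x by exact: fz.
subst z; exists f; last exact: zF.
by apply/fixingE; exact: zc.
Qed.

End TypeDefined.

(** * The relation of lying in the same coset *)

Section Subgroups.
Variables (gT : groupType) (G : set gT).
Hypothesis G_group : group_closed [in G].

Lemma set_group1 : G 1. Proof. by case: G_group => /set_mem. Qed.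

Lemma set_groupV f : G f -> G f^-1.
Proof. by move=> /mem_set /(group_closedV G_group) /set_mem. Qed.

Lemma set_groupM f g : G f -> G g -> G (f * g).
Proof.
by move=> /mem_set Hf /mem_set Hg; apply/set_mem/(group_closedM G_group).
Qed.

End Subgroups.

Section Cosets.
Variables (K : Type) (L : language) (M : structure L).
Hypotheses (KL : uncountable_strong_limit K) (MS : saturated K M)
  (MH : strongly_homogeneous K M).

(** When [G] contains the automorphisms fixing [a], the classes on the conjugates
of [a] are the left cosets of [G]. The first disjunct makes the relation
reflexive on the other tuples. *)
Definition coset_eq (I : Type) (a : I -> M) (G : set (aut M)) (z z' : I -> M) :=
  z = z' \/ exists k k' : aut M,
    [/\ z = k \o a, z' = k' \o a & G (k^-1 * k')].

Lemma coset_eq_equiv (I : Type) (a : I -> M) (G : set (aut M)) :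
  group_closed [in G] -> (forall f : aut M, f \o a = a -> G f) ->
  Equivalence (coset_eq a G).
Proof.
move=> GG aG.
split.
- by move=> z; left.
- move=> z z' [->|[k [k' [-> -> Gk]]]]; first by left.
  right; exists k', k; split=> //.
  by have := set_groupV GG Gk; rewrite invgM invgK.
- move=> x y z [->//|[k [k' [-> -> Gk]]]] [<-|[l [l' [E -> Gl]]]].
    by right; exists k, k'.
  right; exists k, l'; split=> //.
  have -> : k^-1 * l' = (k^-1 * k') * (k'^-1 * l) * (l^-1 * l').
    by rewrite !mulgA mulgK mulgK.
  apply: set_groupM => //; apply: set_groupM => //; apply: aG.
  have -> : (k'^-1 * l : aut M) \o a = aut_inv k' \o (l \o a) by [].
  by rewrite -E; apply/funext => i /=; rewrite aut_funK.
Qed.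

(** Membership of [k^-1 * k'] in [G] is moved by [k] to a condition on [k' \o a]
and [k \o b] together with [k(e) = k'(e)]; existentially quantified copies of
[b] and of the representative [r] of [e] then replace [k] and [k']. *)
Lemma pdef_coset_eq (e : hyperimaginary K M) (I J : Type) (a : I -> M)
    (b : J -> M) (Q : (I + J -> M) -> Prop) (G : set (aut M)) :
  small K [set: I] -> small K [set: J] -> pdef Q ->
  (forall f, G f <-> fixing e f /\ Q (tcat (f \o a) b)) ->
  pdef (fun v : I + I -> M => coset_eq a G (v \o inl) (v \o inr)).
Proof.
move=> SI SJ Qp GE; set X := td_idx (hi_eq e); pose r : X -> M := hi_rep e.
have SX : small K [set: X] by exact: td_small.
(* The quantified tuples are [k \o b], [k \o r] and [k' \o r], in this order. *)
pose V : Type := ((J + X) + X) + (I + I).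
pose s1 (i : I + (J + X)) : V := match i with
  | inl i => inr (inl i) | inr j => inl (inl j) end.
pose s2 (i : I + X) : V := match i with
  | inl i => inr (inr i) | inr x => inl (inr x) end.
pose s3 (i : X + X) : V := match i with
  | inl x => inl (inl (inr x)) | inr x => inl (inr x) end.
pose s4 (i : I + J) : V := match i with
  | inl i => inr (inr i) | inr j => inl (inl (inl j)) end.
pose P (w : V -> M) := eqtp (tcat a (tcat b r)) (w \o s1) /\
  (eqtp (tcat a r) (w \o s2) /\
   (hi_eq e (w \o s3 \o inl) (w \o s3 \o inr) /\ Q (w \o s4))).
have SJX : small K [set: J + X] by exact: small_sum.
have PP : pdef P.
  apply: pdef_and; first exact: (pdef_rename s1 (pdef_eqtp_const _)).
  apply: pdef_and; first exact: (pdef_rename s2 (pdef_eqtp_const _)).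
  by apply: pdef_and; [exact: (pdef_rename s3 (pdef_td _))|
    exact: (pdef_rename s4 Qp)].
pose R (v : I + I -> M) := v \o inl = v \o inr \/ exists y, P (tcat y v).
apply: (pdef_ext (Q := R)); last first.
  by apply: pdef_or; [exact: pdef_eq|apply: (pdef_exists KL MS) => //;
    exact: small_sum].
move=> v; split=> -[E|]; [by left| |by left|].
  move=> [k [k' [E E' /GE[/fixingE kk Qk]]]]; right.
  exists (tcat (tcat (k \o b) (k \o r)) (k' \o r)); split.
    by apply/(eqtpP MH); [exact: small_sum|exists k; apply/funext => -[i|[]]//=;
      exact: (congr1 (fun f => f i) E)].
  split.
    by apply/(eqtpP MH); [exact: small_sum|exists k'; apply/funext => -[i|]//=;
      exact: (congr1 (fun f => f i) E')].
  have kV (U : Type) (x : U -> M) : k \o ((k^-1 * k' : aut M) \o x) = k' \o x.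
    exact: aut_compV.
  split.
    have /(td_aut k) := kk; rewrite kV => H.
    by have [_ sym _] := td_equiv (hi_eq e); exact: sym.
  move: Qk => /(pdef_aut k _ Qp).
  suff -> : k \o tcat ((k^-1 * k' : aut M) \o a) b =
    tcat (tcat (tcat (k \o b) (k \o r)) (k' \o r)) v \o s4 by [].
  apply/funext => -[i|//].
  apply: etrans (congr1 (fun f => f i) (kV _ a)) _.
  exact: (esym (congr1 (fun f => f i) E')).
move=> [y [/(eqtpP MH)[|k kE]]]; first exact: small_sum.
move=> [/(eqtpP MH)[|k' kE']]; first exact: small_sum.
move=> [ee Qy]; right; exists k, k'.
have kV (U : Type) (x : U -> M) : k \o ((k^-1 * k' : aut M) \o x) = k' \o x.
  exact: aut_compV.
have Ea : v \o inl = k \o a.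
  by apply/funext => i; exact: (congr1 (fun f => f (inl i)) kE).
have Ea' : v \o inr = k' \o a.
  by apply/funext => i; exact: (congr1 (fun f => f (inl i)) kE').
split=> //; apply/GE; split.
  apply/fixingE/(td_aut k); rewrite kV.
  have [_ sym _] := td_equiv (hi_eq e); apply: sym.
  have -> : k' \o hi_rep e = tcat y v \o s3 \o inr.
    by apply/funext => i; exact: (esym (congr1 (fun f => f (inr i)) kE')).
  have -> : k \o hi_rep e = tcat y v \o s3 \o inl.
    by apply/funext => i; exact: (esym (congr1 (fun f => f (inr (inr i))) kE)).
  exact: ee.
apply/(pdef_aut k _ Qp).
suff -> : k \o tcat ((k^-1 * k' : aut M) \o a) b = tcat y v \o s4 by [].
apply/funext => -[i|i].
  apply: etrans (congr1 (fun f => f i) (kV _ a)) _.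
  exact: (esym (congr1 (fun f => f i) Ea')).
exact: (esym (congr1 (fun f => f (inr (inl i))) kE)).
Qed.

Lemma pdef_definable_over0 (I : Type) (R : (I -> M) -> (I -> M) -> Prop) :
  pdef (fun v : I + I -> M => R (v \o inl) (v \o inr)) ->
  type_definable_over set0 R.
Proof.
move=> /(pdef_rename (@inl _ (set0 : set M))) [p pP].
by exists p => x y; rewrite -pP.
Qed.

End Cosets.

(** * Closed subsets of the Galois group *)

Section Galois.
Variables (K : Type) (L : language) (M : structure L).
Hypotheses (KL : uncountable_strong_limit K) (MS : saturated K M)
  (MH : strongly_homogeneous K M).
Variables (e : hyperimaginary K M) (A B : model_over e).

Lemma Autf_fix (f : Aut_e e) (C : model_over e) :
  fixing_pointwise C (val f) -> Autf_e f.
Proof. by move=> fC; apply: sub_gen_smallest; exists C. Qed.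

(** If [k] fixes [B] and sends [f(A)] to [g(A)], then [k] and [g^-1 * k * f] fix
models over [e]; so [f] and [g] have the same image in the Galois group. This is
what makes [nu] independent of the chosen representatives. *)
Lemma gal_pi_eqtp (f g : Aut_e e) :
  eqtp (tcat (val f \o (val : A -> M)) (val : B -> M))
       (tcat (val g \o (val : A -> M)) (val : B -> M)) ->
  gal_pi f = gal_pi g.
Proof.
move=> /(homogeneous_tuple MH)[|k kE].
  by apply: (small_sum KL); apply: small_setT; exact: mo_small.
have kB : fixing_pointwise B k.
  move=> b Bb; have bB : b \in (B : set M) by exact/mem_set.
  exact: (congr1 (fun h => h (inr (exist _ b bB))) kE).
have ke : k \in fixing e by apply/mem_set; exact: (mo_dcl kB).
pose k' : Aut_e e := exist _ k ke.
have Ak' : Autf_e k' by exact: (Autf_fix (C := B)).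
pose u : Aut_e e := g^-1 * (k' * f).
have Au : Autf_e u.
  apply: (Autf_fix (C := A)) => a Aa.
  have aA : a \in (A : set M) by exact/mem_set.
  have : k (val f a) = val g a.
    exact: (congr1 (fun h => h (inl (exist _ a aA))) kE).
  move=> kfg; have -> : val u a = aut_inv (val g) (k (val f a)) by [].
  by rewrite kfg aut_funK.
apply/gal_piP.
have -> : f^-1 * g = (k' ^ f) * u^-1.
  by rewrite /u /conjg !invgM invgK !mulgA mulgK mulgK.
by apply: Autf_M; [exact: Autf_conj|exact: Autf_V].
Qed.

Definition tp_point (f : Aut_e e) : type_space A B :=
  exist _ (tp B (fun a : A => val f (val a)))
    (mem_set (ex_intro2 _ _ (val f) (set_valP f) erefl)).

Lemma nu_tp_point (f : Aut_e e) : nu A B (tp_point f) = gal_pi f.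
Proof.
rewrite /nu; case: cid => g /= E; apply: gal_pi_eqtp => phi.
have := congr1 (fun p : complete_type B A => ct_set p phi) E.
by rewrite /= /sat_in => ->.
Qed.

(** The sets of types containing a given formula form a subbase. *)
Lemma open_stone (W : set (complete_type B A)) (p : complete_type B A) :
  open W -> W p -> exists D : set (formula L (A + B)),
    [/\ finite_set D, D `<=` p & forall q : complete_type B A, D `<=` q -> W q].
Proof.
move=> oW Wp.
pose base (phi : formula L (A + B)) :=
  [set q : complete_type B A | ct_set q phi].
have [I IF IW] : exists2 I : set (set (complete_type B A)),
  I `<=` finI_from setT base & \bigcup_(C in I) C = W := oW.
move: Wp; rewrite -IW => -[C IC Cp]; have [D _ CE] := IF _ IC.
exists [set` D]; split; first exact: finite_fset.
  by move=> phi Dphi; move: Cp; rewrite -CE => /(_ phi Dphi).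
by move=> q Dq; exists C => //; rewrite -CE => phi /Dq.
Qed.

(** The formulas true of [(f(A), B)] for every [f] in the preimage of [H']
suffice: a type outside a closed set is separated from it by finitely many
formulas, and the negation of their conjunction holds throughout the closed
set. *)
Lemma pdef_closed (H' : set (Gal_L e)) : gal_closed A B H' ->
  exists2 Q : (A + B -> M) -> Prop, pdef Q &
    forall f : Aut_e e, H' (gal_pi f) <->
      Q (tcat (val f \o (val : A -> M)) (val : B -> M)).
Proof.
move=> /closed_openC oH.
pose v (f : Aut_e e) := tcat (val f \o (val : A -> M)) (val : B -> M).
pose p := [set phi : formula L (A + B) |
  forall f, H' (gal_pi f) -> sat phi (v f)].
exists (fun w => forall phi, p phi -> sat phi w); first by exists p.
move=> f; split=> [Hf phi|H]; first exact.
apply: contrapT => Nf.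
have [W oW WE] : open (nu A B @^-1` ~` H') by exact: oH.
have ptW (g : Aut_e e) :
    W (tp B (fun a : A => val g (val a))) <-> ~ H' (gal_pi g).
  by have := congr1 (fun U : set (type_space A B) => U (tp_point g)) WE;
    rewrite /preimage /= nu_tp_point => ->.
have [D [fD Df DW]] := open_stone oW ((ptW f).2 Nf).
have [psi psiD] := finite_conj M fD.
have /H : p (Neg psi).
  move=> g Hg /psiD gD; apply: (ptW g).1 Hg; apply: DW => phi /gD; exact.
by apply; apply/psiD => phi /Df.
Qed.

End Galois.

(** * Bounding images by numbers of types *)

Section Bounded.
Variables (K : Type) (KL : uncountable_strong_limit K).

Lemma small_image_factor (X Y Z : Type) (D : set X) (h : X -> Y) (t : X -> Z) :
  small K [set: Z] ->
  (forall x y, D x -> D y -> t x = t y -> h x = h y) -> small K (h @` D).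
Proof.
move=> SZ th; have [->|/set0P[x0 Dx0]] := eqVneq D set0.
  apply: (small_card_le _ SZ); rewrite image_set0; exact: card_ge0.
have /choice[g gP] : forall z, exists y, forall x, D x -> t x = z -> h x = y.
  move=> z; have [[x [Dx tx]]|N] := EM (exists x, D x /\ t x = z).
    by exists (h x) => x' Dx' tx'; apply: th => //; rewrite tx.
  by exists (h x0) => x Dx tx; case: N; exists x.
apply: (small_card_le _ (small_image g SZ)); apply: subset_card_le.
by move=> _ [x Dx <-]; exists (t x) => //; exact/esym/gP.
Qed.

(** There is only a small number of types in a small tuple of variables. *)
Lemma small_image_eqtp (L : language) (M : structure L) (X Y V : Type)
    (D : set X) (h : X -> Y) (v : X -> V -> M) :
  small K [set: fsymb L] -> small K [set: rsymb L] -> small K [set: V] ->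
  (forall x y, D x -> D y -> eqtp (v x) (v y) -> h x = h y) ->
  small K (h @` D).
Proof.
move=> SF SR SV vh.
apply: (small_image_factor (t := fun x => [set phi | sat phi (v x)])).
  by apply/(small_pow KL)/small_formula.
move=> x y Dx Dy E; apply: vh => // phi.
by have := congr1 (fun p : set _ => p phi) E; rewrite /= => ->.
Qed.

End Bounded.

(** * Orbit equivalence relations *)

Section OrbitEq.
Variables (K : Type) (L : language) (M : structure L) (G : set (aut M)).
Hypothesis G_group : group_closed [in G].

Lemma orbit_eq_equiv (F : tdequiv K M) : Equivalence (orbit_eq G F).
Proof.
split.
- by move=> x; exists 1; [exact: set_group1|exact: act1].
- move=> x y [f Gf fxy]; exists f^-1; first exact: set_groupV.
  by rewrite -fxy -actM mulVg act1.
- move=> x y z [f Gf fxy] [g Gg gyz]; exists (g * f); first exact: set_groupM.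
  by rewrite actM fxy.
Qed.

Lemma orbit_eq_comp (F : tdequiv K M) (f : aut M) (x : real_tuple F) :
  G f -> orbit_eq G F x (f \o x).
Proof.
by move=> Gf; apply/orbit_eqE; exists f => //; have [refl _ _] := td_equiv F.
Qed.

End OrbitEq.

(** * The hyperimaginary stabilized by a closed subgroup *)

Section Main.
Variables (L : language) (K : Type) (T : set (sentence L)) (M : structure L).
Hypothesis M_monster : monster K T M.
Variables (e : hyperimaginary K M) (A B : model_over e) (H' : set (Gal_L e)).
Hypothesis H'_subgroup : group_closed [in H'].
Hypothesis H'_closed : gal_closed A B H'.

Let KL := monster_card M_monster.
Let MS := monster_saturated M_monster.
Let MH := monster_homogeneous M_monster.

Definition preimage_group : set (aut M) := [set val f | f in gal_pi @^-1` H'].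
Local Notation H := preimage_group.

Lemma preimage_groupE (f : Aut_e e) : H (val f) <-> H' (gal_pi f).
Proof. by split=> [[g Hg /val_inj <-]|Hf]; [|exists f]. Qed.

Lemma preimage_group_fixing f : H f -> fixing e f.
Proof. by move=> [g _ <-]; exact: set_valP. Qed.

Lemma preimage_group_subgroup : group_closed [in H].
Proof.
split.
  by apply/mem_set; exists 1 => //=; apply/set_mem; case: H'_subgroup.
move=> _ _ /set_mem[f Hf <-] /set_mem[g Hg <-]; apply/mem_set.
exists (f * g^-1) => //=; rewrite -gal_piM -gal_piV.
by apply/set_mem; case: H'_subgroup => _; apply; exact/mem_set.
Qed.

Lemma preimage_group_Autf (f : Aut_e e) : Autf_e f -> H (val f).
Proof.
move=> Af; apply/preimage_groupE.
have -> : gal_pi f = gal_pi 1 by apply/esym/gal_piP; rewrite invg1 mul1g.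
by apply/set_mem; case: H'_subgroup.
Qed.

(** Applied to [A], this is why the cosets of the preimage of [H'] can be read
off the images of [A]. *)
Lemma preimage_group_fix (C : model_over e) (f : aut M) :
  f \o (val : C -> M) = val -> H f.
Proof.
move=> fC; have fixC : fixing_pointwise C f.
  by move=> c /mem_set Cc; exact: (congr1 (fun h => h (exist _ c Cc)) fC).
have fe : f \in fixing e by apply/mem_set/(mo_dcl fixC).
by apply: (preimage_group_Autf (f := exist _ f fe)); exact: (Autf_fix (C := C)).
Qed.

Lemma pdef_preimage_group : exists2 Q : (A + B -> M) -> Prop, pdef Q &
  forall f : aut M,
    H f <-> fixing e f /\ Q (tcat (f \o (val : A -> M)) (val : B -> M)).
Proof.
have [Q Qp QE] := pdef_closed KL MH H'_closed; exists Q => // f; split.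
  by move=> [g Hg <-]; split; [exact: set_valP|exact/QE].
move=> [/mem_set fe Qf]; apply/(preimage_groupE (exist _ f fe)).
exact/QE.
Qed.

Lemma small_model (C : model_over e) : small K [set: C].
Proof. by apply: small_setT; exact: mo_small. Qed.

Definition coset_tdequiv : tdequiv K M := TdEquiv (small_model A)
  (pdef_definable_over0 (let: ex_intro2 Q Qp QE := pdef_preimage_group in
    pdef_coset_eq KL MS MH (small_model A) (small_model B) Qp QE))
  (coset_eq_equiv preimage_group_subgroup (@preimage_group_fix A)).

Definition coset_hyperimaginary : hyperimaginary K M :=
  @Hyperimaginary K L M coset_tdequiv (val : A -> M).

Let HV := set_groupV preimage_group_subgroup.
Let HM := set_groupM preimage_group_subgroup.

(** The class of [A] is sent by [f] to the class of [f(A)], that is, the coset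
of [1] is sent to the coset of [f]. *)
Lemma fixing_coset_hyperimaginary f : fixing coset_hyperimaginary f <-> H f.
Proof.
rewrite fixingE; split=> [[|[k [k' [Ek Ek' Hkk]]]]|Hf].
- exact: preimage_group_fix.
- have Hk' : H k' by exact: (preimage_group_fix (C := A) (esym Ek')).
  have Hk : H k.
    have -> : k = k' * (k^-1 * k')^-1 by rewrite invgM invgK mulgA mulgV mul1g.
    by apply: HM => //; exact: HV.
  have -> : f = k * (k^-1 * f) by rewrite mulgA mulgV mul1g.
  apply: HM => //; apply: (preimage_group_fix (C := A)).
  have -> : (k^-1 * f : aut M) \o (val : A -> M) =
      aut_inv k \o (f \o val) by [].
  by rewrite [f \o _]Ek; apply/funext => a /=; rewrite aut_funK.
- by right; exists f, 1; split=> //; rewrite mulg1; exact: HV.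
Qed.

(** The conjugates of [e'] over [e] correspond to cosets, and the coset of [f]
is determined by the type of [f(A)] over [B]. *)
Lemma coset_hyperimaginary_bdd : in_bdd coset_hyperimaginary e.
Proof.
apply: (small_image_eqtp KL (v := fun f : aut M =>
  tcat (f \o (val : A -> M)) (val : B -> M))).
- exact: monster_fsymb M_monster.
- exact: monster_rsymb M_monster.
- by apply: (small_sum KL); exact: small_model.
move=> f g /mem_set fe /mem_set ge fg.
pose f' : Aut_e e := exist _ f fe; pose g' : Aut_e e := exist _ g ge.
have /gal_piP/preimage_group_Autf/fixing_coset_hyperimaginary Efg :
    gal_pi f' = gal_pi g'.
  exact: (gal_pi_eqtp KL MH (f := f') (g := g') fg).
have -> : g = f * (f^-1 * g) by rewrite mulgA mulgV mul1g.
by rewrite actM; congr act; exact: esym Efg.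
Qed.

Variable F : tdequiv K M.

Lemma orbit_eq_coset_hyperimaginary x y :
  orbit_eq H F x y <-> equiv_over coset_hyperimaginary e F x y.
Proof.
split=> -[f Hf fxy]; exists f => //.
  by split; [exact/fixing_coset_hyperimaginary|exact: preimage_group_fixing].
by case: Hf => /fixing_coset_hyperimaginary.
Qed.

Lemma orbit_eq_invariant :
  invariant_under (fixing coset_hyperimaginary `&` fixing e) (orbit_eq H F).
Proof.
have [_ sym trans] := orbit_eq_equiv preimage_group_subgroup F.
move=> f [/fixing_coset_hyperimaginary Hf _] x y.
have fo (z : real_tuple F) := orbit_eq_comp z Hf.
split=> xy.
  exact: (trans _ _ _ (trans _ _ _ (sym _ _ (fo x)) xy) (fo y)).
exact: (trans _ _ _ (trans _ _ _ (fo x) xy) (sym _ _ (fo y))).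
Qed.

Lemma orbit_eq_type_definable : type_definable K (orbit_eq H F).
Proof.
have [C SC [p pP]] := type_definable_conjugacy KL MS MH coset_hyperimaginary F.
exists C => //; exists p => x y; rewrite -pP.
by split=> -[f /fixing_coset_hyperimaginary Hf fxy]; exists f.
Qed.

(** Tuples with the same type over [A] are conjugate by an automorphism fixing
[A], and such an automorphism belongs to [H]. *)
Lemma orbit_eq_bounded : bounded_equiv K (orbit_eq H F).
Proof.
have Req := orbit_eq_equiv preimage_group_subgroup F.
have [_ sym trans] := Req.
split=> //; apply: (small_image_eqtp KL (v := fun x : real_tuple F =>
  tcat x (val : A -> M))).
- exact: monster_fsymb M_monster.
- exact: monster_rsymb M_monster.
- by apply: (small_sum KL); [exact: td_small|exact: small_model].
move=> x y _ _ /(eqtpP MH)[|f fE].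
  by apply: (small_sum KL); [exact: td_small|exact: small_model].
have Hf : H f.
  apply: (preimage_group_fix (C := A)); apply/funext => a.
  exact: (esym (congr1 (fun h => h (inr a)) fE)).
have xy : orbit_eq H F x y.
  have -> : y = f \o x.
    by apply/funext => i; exact: (congr1 (fun h => h (inl i)) fE).
  exact: orbit_eq_comp.
by apply/seteqP; split=> z; [exact: trans (sym _ _ xy)|exact: trans xy].
Qed.

Lemma orbit_eq_normal_invariant : (forall g h : Gal_L e, H' h -> H' (h ^ g)) ->
  invariant_under (fixing e) (orbit_eq H F).
Proof.
move=> Hn.
have half (f : Aut_e e) (x y : real_tuple F) :
    orbit_eq H F x y -> orbit_eq H F (val f \o x) (val f \o y).
  move=> /orbit_eqE[_ [g Hg <-] gxy]; apply/orbit_eqE.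
  exists (val (g ^ f^-1)).
    apply/preimage_groupE.
    have -> : gal_pi (g ^ f^-1) = (gal_pi g) ^ (gal_pi f)^-1.
      by rewrite /conjg -!gal_piM -!gal_piV.
    exact: Hn.
  have -> : (val (g ^ f^-1) : aut M) \o (val f \o x) = val f \o (val g \o x).
    have -> : g ^ f^-1 = f * g * f^-1 by rewrite /conjg invgK mulgA.
    apply/funext => i; rewrite /=; congr (val f (val g _)).
    exact: aut_funK.
  exact/td_aut.
move=> f /mem_set fe x y; pose f' : Aut_e e := exist _ f fe.
split=> [|/(half f'^-1)]; first exact: (half f').
have fV (z : real_tuple F) : (val f'^-1 : aut M) \o (f \o z) = z.
  by apply/funext => i; exact: (aut_funK f).
by rewrite !fV.
Qed.

End Main.

Theorem corollary2p4 (L : language) (K : Type) (T : set (sentence L))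
  (M : structure L) (T_complete : complete_theory T) (M_monster : monster K T M)
  (e : hyperimaginary K M)
  (A B : model_over e)
  (H' : set (Gal_L e)) (H'_subgroup : group_closed [in H'])
  (H'_closed : gal_closed A B H')
  (F : tdequiv K M) :
  let H : set (aut M) := [set val f | f in gal_pi @^-1` H'] in
  let R := orbit_eq H F in
  (exists e' : hyperimaginary K M,
    [/\ in_bdd e' e,
        (forall x y : real_tuple F, R x y <-> equiv_over e' e F x y),
        invariant_under (fixing e' `&` fixing e) R,
        type_definable K R &
        bounded_equiv K R]) /\
  ((forall g h : Gal_L e, H' h -> H' (h ^ g)) ->
    invariant_under (fixing e) R).
Proof.
split; last exact: orbit_eq_normal_invariant.
exists (coset_hyperimaginary M_monster H'_subgroup H'_closed); split.
- exact: coset_hyperimaginary_bdd.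
- exact: orbit_eq_coset_hyperimaginary.
- exact: orbit_eq_invariant.
- exact: (orbit_eq_type_definable M_monster H'_subgroup H'_closed).
- exact: (orbit_eq_bounded M_monster A).
Qed.
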